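(* The functors $\mathcal{F},\mathcal{K},\mathcal{X},\mathcal{A},\mathcal{Y},\mathcal{V}^a$ restrict to yield an equivalence between ${\sf BrwA_P}$ and ${\sf BrwArFrm}$, and dual equivalences between ${\sf BrwA_P}$ and ${\sf PES_P}$ and between ${\sf BrwArFrm}$ and ${\sf PES_P}$, and the resulting triangle commutes up to natural isomorphism (i.e. $\mathcal{Y}\circ\mathcal{F}\cong\mathcal{X}$ and $\mathcal{F}\circ\mathcal{A}\cong\mathcal{V}^a$ on these categories).
   Context: Algebra. A meet-semilattice is a poset with all finite meets (top included, bottom possibly absent). A filter is a nonempty upset closed under binary meets; $\mathcal{F}(A)$ is the frame of filters ordered by inclusion; prime filters are meet-prime elements of $\mathcal{F}(A)$; a filter $F$ is optimal if $a_1,\dots,a_n\notin F$ and $\bigcap_i{\uparrow}a_i\subseteq{\uparrow}c$ imply $c\notin F$. A Brouwerian semilattice has $\to$ with $x\le a\to b$ iff $a\wedge x\le b$; a Brouwerian algebra is a Brouwerian semilattice that is a lattice. ${\sf BrwA_P}$: Brouwerian algebras with maps $h$ preserving finite meets (including top), implication, all existing finite joins, and with $h^{-1}(P)$ a prime filter for each prime filter $P$. Frames. $K(L)$ = compact elements; algebraic = every element a join of compacts; arithmetic = algebraic and $K(L)$ closed under binary meets; $K(L)^d$ = reverse order. A Brouwerian frame is an algebraic frame with $K(L)^d$ a Brouwerian semilattice. ${\sf BrwArFrm}$: arithmetic Brouwerian frames with frame homomorphisms $\alpha$ sending compacts to compacts and with $\alpha(a\to b)=\alpha(a)\to\alpha(b)$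 for $a,b\in K(L)$, implications computed in $K(L)^d$, $K(M)^d$. $a\ll b$ means $b\le\bigvee S$ implies $a\le\bigvee T$ for finite $T\subseteq S$; $p\ne1$ is prime if $a\wedge b\le p$ implies $a\le p$ or $b\le p$, pseudoprime if $a_1\wedge\dots\wedge a_n\ll p$ implies some $a_i\le p$; $P(L),PP(L)$ the sets of these. Spaces. An Esakia space is a compact ordered space such that $x\not\le y$ gives a clopen upset containing $x$ not $y$, and ${\downarrow}U$ is clopen for each clopen $U$; an Esakia morphism is a continuous $f$ with ${\downarrow}f^{-1}(y)=f^{-1}({\downarrow}y)$. A pointed Esakia space $(X,m)$ is an Esakia space with unique maximum $m$, regarded as the triple $(X,X\setminus\{m\},m)$. ${\sf PES_P}$: pointed Esakia spaces with Esakia morphisms $f:(X,m)\to(Y,n)$ satisfying $f^{-1}(\{n\})=\{m\}$. For a triple $(X,X_0,m)$, $U$ is admissible if $X\setminus U\subseteq{\downarrow}(X_0\setminus U)$, and $\mathcal{A}(X)$ is the set of admissible clopen upsets. Functors. $\mathcal{F}(A)$ = filter frame, $\mathcal{F}(h)(F)={\uparrow}h[F]$. $\mathcal{K}(L)=K(L)^d$, $\mathcal{K}(\alpha)=\alpha|_{K(L)}$. $\mathcal{A}(X)$ ordered by inclusion, $\mathcal{A}(f)=f^{-1}$. $\mathcal{X}(A)$: the set of optimal filters of $A$ together with $A$, ordered by inclusion, subbasis $\{\varphi(a)\}\cup\{\text{complement of }\varphi(b)\}$ with $\varphi(a)=\{x:a\in x\}$, with distinguished set the prime filters and point $A$; $\mathcal{X}(h)=h^{-1}(-)$.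 $\mathcal{V}^a(X)$: admissible closed upsets ordered by reverse inclusion, $\mathcal{V}^a(f)=f^{-1}$. $\mathcal{Y}(L)$: $Y_L=PP(L)\cup\{1\}$ with order of $L$, subbasis $\{{\uparrow}k\cap Y_L\}\cup\{Y_L\setminus{\uparrow}l\}$, $k,l\in K(L)$, distinguished set $P(L)$, point $1$; $\mathcal{Y}(\alpha)$ is the right adjoint $r(b)=\bigvee\{a:\alpha(a)\le b\}$ restricted to these points. *)

(* Defs.v *)
From HB Require Import structures.
From mathcomp Require Import all_boot all_order.
From mathcomp Require Import boolp classical_sets functions cardinality filter.
From mathcomp Require Import topology.
Set Implicit Arguments.
Unset Strict Implicit.
Unset Printing Implicit Defensive.
Import Order.TTheory.
Local Open Scope classical_set_scope.
Local Open Scope order_scope.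

Record category := Category {
  obj :> Type;
  hom : obj -> obj -> Type;
  idm : forall A, hom A A;
  comp : forall A B C, hom B C -> hom A B -> hom A C;
  comp_idl : forall A B (f : hom A B), comp (idm B) f = f;
  comp_idr : forall A B (f : hom A B), comp f (idm A) = f;
  comp_assoc : forall A B C D (f : hom A B) (g : hom B C) (h : hom C D),
    comp h (comp g f) = comp (comp h g) f }.
Arguments hom {C} A B : rename.
Arguments idm {C} A : rename.
Arguments comp {C0 A B C} g f : rename.

Definition op (C : category) : category :=
  @Category C (fun A B => hom B A) (fun A => idm A)
    (fun A B C g f => comp f g)
    (fun A B f => comp_idr f) (fun A B f => comp_idl f)
    (fun A B C D f g h => esym (comp_assoc h g f)).

Record functor (C D : category) := Functor {
  fobj :> C -> D;
  fmap : forall A B : C, hom A B -> hom (fobj A) (fobj B);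
  fmap_id : forall A : C, fmap (idm A) = idm (fobj A);
  fmap_comp : forall (A B E : C) (g : hom B E) (f : hom A B),
    fmap (comp g f) = comp (fmap g) (fmap f) }.
Arguments fmap {C D} F {A B} f : rename.

Definition id_functor (C : category) : functor C C :=
  @Functor C C id (fun A B f => f) (fun A => erefl) (fun A B E g f => erefl).

Definition comp_functor (C D E : category) (G : functor D E) (F : functor C D) :
  functor C E.
Proof.
refine (@Functor C E (fun A => G (F A)) (fun A B f => fmap G (fmap F f)) _ _).
- by move=> A; rewrite !fmap_id.
- by move=> A B X g f; rewrite !fmap_comp.
Defined.

Definition op_functor (C D : category) (F : functor C D) :
  functor (op C) (op D) :=
  @Functor (op C) (op D) F (fun A B (f : @hom C B A) => fmap F f)
    (fun A => fmap_id F A) (fun A B E g f => fmap_comp F f g).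

Definition flip_functor (C D : category) (F : functor (op C) D) :
  functor C (op D) :=
  @Functor C (op D) F (fun A B (f : @hom (op C) B A) => fmap F f)
    (fun A => fmap_id F A) (fun A B E g f => @fmap_comp _ _ F E B A f g).

Definition is_iso (C : category) (A B : C) (f : hom A B) : Prop :=
  exists g : hom B A, comp g f = idm A /\ comp f g = idm B.

Definition naturally_isomorphic (C D : category) (F G : functor C D) : Prop :=
  exists eta : forall A : C, hom (F A) (G A),
    (forall (A B : C) (f : hom A B),
       comp (eta B) (fmap F f) = comp (fmap G f) (eta A)) /\
    (forall A : C, is_iso (eta A)).

Definition equivalence (C D : category) (F : functor C D) (G : functor D C) :
  Prop :=
  naturally_isomorphic (comp_functor G F) (id_functor C) /\
  naturally_isomorphic (comp_functor F G) (id_functor D).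

Definition dual_equivalence (C D : category)
    (F : functor (op C) D) (G : functor (op D) C) : Prop :=
  equivalence F (flip_functor G).

(* The objects are the [raw] structures satisfying [is_obj], the morphisms are the
   maps between carriers satisfying [is_mor]. *)
Record concrete := Concrete {
  raw : Type;
  carrier : raw -> Type;
  is_obj : raw -> Prop;
  is_mor : forall A B : raw, (carrier A -> carrier B) -> Prop;
  is_mor_id : forall A, is_mor (@id (carrier A));
  is_mor_comp : forall A B C (g : carrier B -> carrier C)
    (f : carrier A -> carrier B), is_mor g -> is_mor f -> is_mor (g \o f) }.
Arguments carrier {c}.
Arguments is_obj {c}.
Arguments is_mor {c A B}.

Definition chom (C : concrete) (A B : raw C) :=
  {f : carrier A -> carrier B | is_mor f}.
Definition cid (C : concrete) (A : raw C) : chom A A :=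
  exist _ id (is_mor_id A).
Definition ccomp (C : concrete) (A B E : raw C) (g : chom B E) (f : chom A B) :
  chom A E := exist _ (sval g \o sval f) (is_mor_comp (svalP g) (svalP f)).

Lemma chom_eq (C : concrete) (A B : raw C) (f g : chom A B) :
  sval f = sval g -> f = g.
Proof. by move=> fg; apply: eq_sig_hprop fg => ? ? ?; exact: Prop_irrelevance. Qed.

Definition category_of (C : concrete) : category.
Proof.
refine (@Category {A : raw C | is_obj A} (fun A B => chom (sval A) (sval B))
  (fun A => cid (sval A)) (fun A B E g f => ccomp g f) _ _ _).
all: by move=> *; exact: chom_eq.
Defined.
Coercion category_of : concrete >-> category.

(* The functors C -> D whose object part is the given operation [fo], and whose
   value at a morphism f is a map related to f by [fm].  That [fo] takes values
   in the objects of D is the field [res_obj]: having such a functor says that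
   [fo] and [fm] do restrict to a functor from C to D. *)
Record restriction (C D : concrete) (fo : C -> raw D)
    (fm : forall A B : C, (carrier (sval A) -> carrier (sval B)) ->
            (carrier (fo A) -> carrier (fo B)) -> Prop) := Restriction {
  res_obj : forall A : C, is_obj (fo A);
  res_map : forall A B : C, hom A B -> chom (fo A) (fo B);
  res_mapP : forall (A B : C) (f : hom A B), fm A B (sval f) (sval (res_map f));
  res_id : forall A : C, res_map (idm A) = cid (fo A);
  res_comp : forall (A B E : C) (g : hom B E) (f : hom A B),
    res_map (comp g f) = ccomp (res_map g) (res_map f) }.
Arguments restriction : clear implicits.

Definition functor_of (C D : concrete) fo fm (F : restriction C D fo fm) :
  functor C D :=
  @Functor C D (fun A => exist _ (fo A) (res_obj F A))
    (fun A B f => res_map F f) (fun A => res_id F A)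
    (fun A B E g f => res_comp F g f).
Coercion functor_of : restriction >-> functor.

Record corestriction (C D : concrete) (fo : C -> raw D)
    (fm : forall A B : C, (carrier (sval A) -> carrier (sval B)) ->
            (carrier (fo B) -> carrier (fo A)) -> Prop) := Corestriction {
  cores_obj : forall A : C, is_obj (fo A);
  cores_map : forall A B : C, hom A B -> chom (fo B) (fo A);
  cores_mapP : forall (A B : C) (f : hom A B),
    fm A B (sval f) (sval (cores_map f));
  cores_id : forall A : C, cores_map (idm A) = cid (fo A);
  cores_comp : forall (A B E : C) (g : hom B E) (f : hom A B),
    cores_map (comp g f) = ccomp (cores_map f) (cores_map g) }.
Arguments corestriction : clear implicits.

Definition cofunctor_of (C D : concrete) fo fm (F : corestriction C D fo fm) :
  functor (op C) D :=
  @Functor (op C) D (fun A => exist _ (fo A) (cores_obj F A))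
    (fun A B f => cores_map F f) (fun A => cores_id F A)
    (fun A B E g f => cores_comp F f g).
Coercion cofunctor_of : corestriction >-> functor.

Record poset := Poset { pdisp : Order.disp_t; psort :> porderType pdisp }.

Section order_notions.
Context {d : Order.disp_t} {T : porderType d}.
Implicit Types (S : set T) (a b p : T).

Definition is_upset S := forall x y, S x -> x <= y -> S y.
Definition up_closure S : set T := [set y | exists2 x, S x & x <= y].
Definition down_closure S : set T := [set x | exists2 y, S y & x <= y].

Definition is_top (t : T) := forall x : T, x <= t.

(* a -> b exists and equals c. *)
Definition is_imp a b (c : T) :=
  forall x, x <= c <-> exists2 m, infimums [set a; x] m & m <= b.

(* S = set0 gives the top element. *)
Definition meet_semilattice := forall S, finite_set S -> infimums S !=set0.

Definition brouwerian_semilattice :=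
  meet_semilattice /\ forall a b, exists c, is_imp a b c.

Definition brouwerian_algebra :=
  brouwerian_semilattice /\ forall a b, supremums [set a; b] !=set0.

Definition way_below a b := forall S s, supremums S s -> b <= s ->
  exists F t, [/\ F `<=` S, finite_set F, supremums F t & a <= t].

Definition compact_elt (k : T) := way_below k k.

Definition prime_elt p := ~ is_top p /\
  forall a b m, infimums [set a; b] m -> m <= p -> a <= p \/ b <= p.

Definition pseudoprime_elt p := ~ is_top p /\
  forall S m, finite_set S -> infimums S m -> way_below m p ->
    exists2 a, S a & a <= p.

Definition frame := (forall S, supremums S !=set0) /\
  forall a S s m, supremums S s -> infimums [set a; s] m ->
    supremums [set x | exists2 t, S t & infimums [set a; t] x] m.

Definition algebraic_frame := frame /\
  forall x, exists2 S : set T, S `<=` compact_elt & supremums S x.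

Definition arithmetic_frame := algebraic_frame /\
  forall k l m, compact_elt k -> compact_elt l -> infimums [set k; l] m ->
    compact_elt m.

Definition is_filter (F : set T) := [/\ F !=set0, is_upset F &
  forall a b m, F a -> F b -> infimums [set a; b] m -> F m].

(* S = set0 is allowed; it only excludes the improper filter of a poset with a
   bottom, which is put back in [optimals]. *)
Definition optimal (F : set T) := is_filter F /\
  forall (S : set T) c, finite_set S -> (forall a, S a -> ~ F a) ->
    \bigcap_(a in S) up_closure [set a] `<=` up_closure [set c] -> ~ F c.

End order_notions.

Section maps.
Context {d d' : Order.disp_t} {A : porderType d} {B : porderType d'}.
Variable h : A -> B.

(* With S = set0, the top is preserved; joins are preserved where they exist, so
   a bottom is preserved when there is one. *)
Definition preserves_finite_meets := forall S m,
  finite_set S -> infimums S m -> infimums (h @` S) (h m).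
Definition preserves_finite_joins := forall S s,
  finite_set S -> supremums S s -> supremums (h @` S) (h s).
Definition preserves_joins := forall S s,
  supremums S s -> supremums (h @` S) (h s).
Definition preserves_imp := forall a b c,
  is_imp a b c -> is_imp (h a) (h b) (h c).

End maps.

Definition filters (A : poset) := {F : set A | `[< is_filter F >]}.
HB.instance Definition _ (A : poset) := SubChoice.on (filters A).
HB.instance Definition _ (A : poset) :=
  [SubChoice_isSubPOrder of filters A by <: with set_display].

Definition prime_filter (A : poset) (P : set A) :=
  exists2 Q : filters A, val Q = P & prime_elt Q.

Definition brwAP_mor (A B : poset) (h : A -> B) :=
  [/\ preserves_finite_meets h, preserves_imp h, preserves_finite_joins h &
      forall P : set B, prime_filter P -> prime_filter (h @^-1` P)].

Lemma brwAP_mor_id (A : poset) : @brwAP_mor A A id.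
Proof. by split=> // S m _; rewrite image_id. Qed.

Lemma brwAP_mor_comp (A B C : poset) (g : B -> C) (f : A -> B) :
  brwAP_mor g -> brwAP_mor f -> brwAP_mor (g \o f).
Proof.
move=> [g1 g2 g3 g4] [f1 f2 f3 f4]; split.
- move=> S m Sf /(f1 _ _ Sf) /g1; rewrite -image_comp; apply.
  exact: finite_image.
- by move=> a b c /f2 /g2.
- move=> S m Sf /(f3 _ _ Sf) /g3; rewrite -image_comp; apply.
  exact: finite_image.
- by move=> P /g4 /f4.
Qed.

Definition BrwAP : concrete :=
  @Concrete poset (fun A => A) (fun A => @brouwerian_algebra _ A)
    brwAP_mor brwAP_mor_id brwAP_mor_comp.

Definition compacts (L : poset) := {k : L | `[< compact_elt k >]}.
HB.instance Definition _ (L : poset) := SubChoice.on (compacts L).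
HB.instance Definition _ (L : poset) :=
  [SubChoice_isSubPOrder of compacts L by <: with pdisp L].

(* K(L)^d: meets in this poset are joins of L. *)
Definition compacts_dual (L : poset) : poset := Poset (compacts L)^d.

Definition compact_val (L : poset) (k : compacts_dual L) : L :=
  val (k : compacts L).

Definition brouwerian_frame (L : poset) :=
  @algebraic_frame _ L /\ @brouwerian_semilattice _ (compacts_dual L).

Definition brwArFrm_mor (L M : poset) (f : L -> M) :=
  [/\ preserves_joins f, preserves_finite_meets f,
      forall k, compact_elt k -> compact_elt (f k) &
      forall (a b c : compacts_dual L) (a' b' c' : compacts_dual M),
        compact_val a' = f (compact_val a) ->
        compact_val b' = f (compact_val b) ->
        compact_val c' = f (compact_val c) ->
        is_imp a b c -> is_imp a' b' c'].

Lemma brwArFrm_mor_id (L : poset) : @brwArFrm_mor L L id.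
Proof.
split=> //; [by move=> S s; rewrite image_id|by move=> S s _; rewrite image_id|].
by move=> a b c a' b' c' /val_inj -> /val_inj -> /val_inj ->.
Qed.

Lemma brwArFrm_mor_comp (L M N : poset) (g : M -> N) (f : L -> M) :
  brwArFrm_mor g -> brwArFrm_mor f -> brwArFrm_mor (g \o f).
Proof.
move=> [g1 g2 g3 g4] [f1 f2 f3 f4]; split.
- by move=> S s /f1 /g1; rewrite -image_comp.
- move=> S m Sf /(f2 _ _ Sf) /g2; rewrite -image_comp; apply.
  exact: finite_image.
- by move=> k /f3 /g3.
- move=> a b c a' b' c' ea eb ec abc.
  have fP (k : compacts_dual L) :
      exists k' : compacts_dual M, compact_val k' = f (compact_val k).
    have kP : `[< compact_elt (f (compact_val k)) >].
      by apply/asboolP/f3/asboolP; exact: (valP (k : compacts L)).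
    by exists (Sub (f (compact_val k)) kP : compacts M); rewrite /compact_val SubK.
  have [u ua] := fP a; have [v vb] := fP b; have [w wc] := fP c.
  apply: (g4 u v w); rewrite ?ua ?vb ?wc //; exact: (f4 a b c).
Qed.

Definition BrwArFrm : concrete :=
  @Concrete poset (fun L => L)
    (fun L => @arithmetic_frame _ L /\ brouwerian_frame L)
    brwArFrm_mor brwArFrm_mor_id brwArFrm_mor_comp.

(* Raw triples (X, X_0, m): no compatibility is imposed here. *)
Record triple := Triple {
  tdisp : Order.disp_t;
  tsort :> POrderedTopological.type tdisp;
  tset : set tsort;
  tpt : tsort }.
Arguments tset : clear implicits.
Arguments tpt : clear implicits.

Definition esakia_space d (X : POrderedTopological.type d) :=
  [/\ compact [set: X],
      forall x y : X, ~ x <= y ->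
        exists U : set X, [/\ clopen U, is_upset U, U x & ~ U y] &
      forall U : set X, clopen U -> clopen (down_closure U)].

(* A maximum is automatically unique. *)
Definition pointed_esakia_space (X : triple) :=
  [/\ esakia_space X, is_top (tpt X) & tset X = ~` [set tpt X]].

Definition pesP_mor (X Y : triple) (f : X -> Y) :=
  [/\ continuous f,
      forall y, down_closure (f @^-1` [set y]) = f @^-1` (down_closure [set y]) &
      f @^-1` [set tpt Y] = [set tpt X]].

Lemma pesP_mor_id (X : triple) : @pesP_mor X X id.
Proof. by split=> //; move=> x; exact: cvg_id. Qed.

Lemma pesP_mor_comp (X Y Z : triple) (g : Y -> Z) (f : X -> Y) :
  pesP_mor g -> pesP_mor f -> pesP_mor (g \o f).
Proof.
move=> [g1 g2 g3] [f1 f2 f3]; split.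
- by move=> x; apply: continuous_comp; [exact: f1|exact: g1].
- move=> z.
  have -> : (g \o f) @^-1` down_closure [set z] =
            f @^-1` (g @^-1` down_closure [set z]) by [].
  rewrite -g2; apply/seteqP; split=> x /=.
    move=> [u guz xu].
    suff: (f @^-1` down_closure [set f u]) x.
      by move=> [y -> fxu]; exists (f u).
    by rewrite -f2; exists u.
  move=> [y gyz fxy].
  have : (f @^-1` down_closure [set y]) x by exists y.
  by rewrite -f2 => -[u fuy xu]; exists u => //=; rewrite fuy.
- by rewrite comp_preimage g3 f3.
Qed.

Definition PESP : concrete :=
  @Concrete triple (fun X => X) pointed_esakia_space
    pesP_mor pesP_mor_id pesP_mor_comp.

Definition F_obj (A : BrwAP) : raw BrwArFrm := Poset (filters (sval A)).

Definition F_map (A B : BrwAP) (h : sval A -> sval B)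
    (g : filters (sval A) -> filters (sval B)) : Prop :=
  forall F, val (g F) = up_closure (h @` val F).

Definition K_obj (L : BrwArFrm) : raw BrwAP := compacts_dual (sval L).

Definition K_map (L M : BrwArFrm) (f : sval L -> sval M)
    (g : compacts_dual (sval L) -> compacts_dual (sval M)) : Prop :=
  forall k, compact_val (g k) = f (compact_val k).

Definition optimals (A : poset) :=
  {F : set A | `[< optimal F \/ F = [set: A] >]}.
HB.instance Definition _ (A : poset) := SubChoice.on (optimals A).
HB.instance Definition _ (A : poset) :=
  [SubChoice_isSubPOrder of optimals A by <: with set_display].

Definition phi (A : poset) (a : A) : set (optimals A) := [set x | val x a].

Definition optimals_subbasis (A : poset) : set (set (optimals A)) :=
  range (@phi A) `|` range (fun b => ~` @phi A b).
HB.instance Definition _ (A : poset) :=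
  isSubBaseTopological.Build (optimals A) (@optimals_subbasis A) id.

Definition optimals_top (A : poset) : optimals A :=
  Sub [set: A] (asboolT (or_intror erefl)).

Definition X_obj (A : BrwAP) : raw PESP :=
  @Triple _ (optimals (sval A)) [set x | prime_filter (val x)]
    (optimals_top (sval A)).

Definition X_map (A B : BrwAP) (h : sval A -> sval B)
    (g : optimals (sval B) -> optimals (sval A)) : Prop :=
  forall x, val (g x) = h @^-1` val x.

Definition admissible (X : triple) (U : set X) :=
  ~` U `<=` down_closure (tset X `\` U).

Definition admissible_clopen_upsets (X : triple) :=
  {U : set X | `[< [/\ admissible U, clopen U & is_upset U] >]}.
HB.instance Definition _ (X : triple) :=
  SubChoice.on (admissible_clopen_upsets X).
HB.instance Definition _ (X : triple) :=
  [SubChoice_isSubPOrder of admissible_clopen_upsets X by <: with set_display].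

Definition A_obj (X : PESP) : raw BrwAP :=
  Poset (admissible_clopen_upsets (sval X)).

Definition A_map (X Y : PESP) (f : sval X -> sval Y)
    (g : admissible_clopen_upsets (sval Y) ->
         admissible_clopen_upsets (sval X)) : Prop :=
  forall U, val (g U) = f @^-1` val U.

Definition admissible_closed_upsets (X : triple) :=
  {U : set X | `[< [/\ admissible U, closed U & is_upset U] >]}.
HB.instance Definition _ (X : triple) :=
  SubChoice.on (admissible_closed_upsets X).
HB.instance Definition _ (X : triple) :=
  [SubChoice_isSubPOrder of admissible_closed_upsets X by <: with set_display].

(* T^d is the order dual, here reverse inclusion. *)
Definition Va_dual (X : triple) : poset := Poset (admissible_closed_upsets X)^d.

Definition closed_val (X : triple) (U : Va_dual X) : set X :=
  val (U : admissible_closed_upsets X).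

Definition V_obj (X : PESP) : raw BrwArFrm := Va_dual (sval X).

Definition V_map (X Y : PESP) (f : sval X -> sval Y)
    (g : Va_dual (sval Y) -> Va_dual (sval X)) : Prop :=
  forall U, closed_val (g U) = f @^-1` closed_val U.

Definition pseudoprimes (L : poset) :=
  {p : L | `[< pseudoprime_elt p \/ is_top p >]}.
HB.instance Definition _ (L : poset) := SubChoice.on (pseudoprimes L).
HB.instance Definition _ (L : poset) :=
  [SubChoice_isSubPOrder of pseudoprimes L by <: with pdisp L].

Definition up_trace (L : poset) (k : L) : set (pseudoprimes L) :=
  [set p | k <= val p].

Definition pseudoprimes_subbasis (L : poset) : set (set (pseudoprimes L)) :=
  (@up_trace L @` compact_elt) `|` ((fun l => ~` @up_trace L l) @` compact_elt).
HB.instance Definition _ (L : poset) :=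
  isSubBaseTopological.Build (pseudoprimes L) (@pseudoprimes_subbasis L) id.

Lemma frame_has_top (L : BrwArFrm) : exists t : sval L, is_top t.
Proof.
have [_ [[[joins _] _] _]] := svalP L.
by have [t [ubt _]] := joins setT; exists t => x; exact: ubt.
Qed.

Definition pseudoprimes_top (L : BrwArFrm) : pseudoprimes (sval L) :=
  Sub (sval (boolp.cid (frame_has_top L)))
      (asboolT (or_intror (svalP (boolp.cid (frame_has_top L))))).

Definition Y_obj (L : BrwArFrm) : raw PESP :=
  @Triple _ (pseudoprimes (sval L)) [set p | prime_elt (val p)]
    (pseudoprimes_top L).

(* g is the right adjoint of f restricted to the points. *)
Definition Y_map (L M : BrwArFrm) (f : sval L -> sval M)
    (g : pseudoprimes (sval M) -> pseudoprimes (sval L)) : Prop :=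
  forall b, supremums [set a | f a <= val b] (val (g b)).

(* Main.v *)
(* In a Brouwerian algebra the optimal filters are the prime filters together
   with the improper one; in an arithmetic frame pseudoprime and prime elements
   coincide; and an upset of a pointed Esakia space is admissible exactly when
   it contains the maximum.  What remains are Stone-type dualities for possibly
   bottomless Brouwerian algebras: [A] is recovered from its filter frame as the
   dual of the compact (principal) filters, and from its space of prime filters
   as the clopen upsets containing the maximum.  On the frame-space side,
   [p |-> {k compact | k <= p}] identifies [Y L] with [X (K L)] and
   [F |-> \bigcap F] identifies [F (A X)] with [V X], so [Y] and [V] are
   transports of composites of the other functors, and the remaining natural
   isomorphisms follow formally. *)

From mathcomp Require Import all_boot all_order finmap.
From mathcomp Require Import boolp classical_sets functions cardinality filter.
From mathcomp Require Import topology.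
Require Import Defs.
Set Implicit Arguments.
Unset Strict Implicit.
Unset Printing Implicit Defensive.
Import Order.TTheory.
Local Open Scope order_scope.
Local Open Scope classical_set_scope.

(** * Order-theoretic preliminaries *)

(** The obstacle is the possible lack of a bottom. A map preserving finite meets and joins pulls a
    prime filter back to a join-prime filter, but nothing prevents that filter from being improper.
    Each kind of morphism excludes this in its own way, and the three ways have to be translated
    into each other: primeness of preimages for algebras, preservation of the top for frames, and,
    for spaces, the requirement that only the maximum is sent to the maximum. The empty join needs
    the same care: upper bounds of finite sets are taken in directed sets whose nonemptiness is
    argued separately. Two existence principles carry the dualities. On the algebraic side it is
    [prime_separation], from Zorn's lemma and the distributivity that implication forces. On the
    side of spaces it is compactness in the directed form [compact_directed_cover], where a single
    member of the cover suffices. Implication and the Esakia condition on clopen sets are matched by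
    [down_closure_diff]. *)

Lemma finite_set_ind (T : choiceType) (P : set T -> Prop) :
  P set0 -> (forall a S, finite_set S -> P S -> P (a |` S)) ->
  forall S, finite_set S -> P S.
Proof.
move=> P0 PU S /finite_seqP[s ->]; elim: s => [|a s IHs];
  first by rewrite set_nil.
have -> : [set` (a :: s)] = a |` [set` s].
  by apply/seteqP; split=> x /=; rewrite inE => /predU1P.
by apply: PU => //; exact: finite_seq.
Qed.

(** Nonemptiness of [D] takes care of the empty [S], for which a lattice without bottom offers no
    canonical bound. *)
Lemma finite_set_bound (T : choiceType) (R : T -> T -> Prop) (D S : set T) :
  (forall x y z, R x y -> R y z -> R x z) -> D !=set0 ->
  (forall a b, D a -> D b -> exists c, [/\ D c, R a c & R b c]) ->
  finite_set S -> S `<=` D -> exists2 c, D c & forall s, S s -> R s c.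
Proof.
move=> tR [d Dd] dirD Sf; elim/finite_set_ind: S / Sf; first by exists d.
move=> a S _ IHS aSD.
have [|c Dc Sc] := IHS; first by move=> s Ss; apply: aSD; right.
have [|e [De ae ce]] := dirD a c _ Dc; first by apply: aSD; left.
by exists e => // s [->//|/Sc sc]; exact: tR ce.
Qed.

Section order_basics.
Context {d : Order.disp_t} {T : porderType d}.
Implicit Types (S : set T) (a b c m x : T).

Lemma infimumsP S m :
  infimums S m <-> forall x, x <= m <-> forall s, S s -> x <= s.
Proof.
split=> [[mlb mub] x|mP].
  by split=> [xm s /mlb|xS]; [exact: le_trans|apply: mub].
by split=> [s|x xS]; [apply: (mP m).1|apply/mP].
Qed.

Lemma supremumsP S m :
  supremums S m <-> forall x, m <= x <-> forall s, S s -> s <= x.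
Proof.
split=> [[mub mlb] x|mP].
  by split=> [mx s /mub sm|xS]; [exact: le_trans mx|apply: mlb].
by split=> [s|x xS]; [apply: (mP m).1|apply/mP].
Qed.

Lemma infimums2P a b m :
  infimums [set a; b] m <-> forall x, x <= m = (x <= a) && (x <= b).
Proof.
rewrite infimumsP; split=> [mP x|mP x].
  apply/idP/andP => [/mP xS|[xa xb]]; first by split; apply: xS; [left|right].
  by apply/mP => s [] ->.
rewrite mP; split=> [/andP[xa xb] s [] -> //|xS].
by rewrite !xS //; [right|left].
Qed.

Lemma supremums2P a b m :
  supremums [set a; b] m <-> forall x, m <= x = (a <= x) && (b <= x).
Proof.
rewrite supremumsP; split=> [mP x|mP x].
  apply/idP/andP => [/mP xS|[xa xb]]; first by split; apply: xS; [left|right].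
  by apply/mP => s [] ->.
rewrite mP; split=> [/andP[xa xb] s [] -> //|xS].
by rewrite !xS //; [right|left].
Qed.

Lemma infimums0P m : infimums set0 m <-> is_top m.
Proof. by rewrite infimumsP; split=> [mP x|mt x]; [apply/mP|split]. Qed.

Lemma infimums_ge a b : a <= b -> infimums [set a; b] a.
Proof.
by move=> ab; apply/infimums2P => x; rewrite andb_idr // => /le_trans; apply.
Qed.

Lemma infimumsU1 a S m n : infimums S n ->
  infimums (a |` S) m <-> infimums [set a; n] m.
Proof.
move=> /infimumsP nP; rewrite infimumsP infimums2P; split=> mP x.
  apply/idP/andP => [/mP xS|[xa /nP xS]]; last by apply/mP => s [->|/xS].
  by split; [apply: xS; left|apply/nP => s Ss; apply: xS; right].
rewrite mP; split=> [/andP[xa /nP xS] s [->|/xS]//|xS].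
by apply/andP; split; [apply: xS; left|apply/nP => s Ss; apply: xS; right].
Qed.

Lemma infimums_unique S m n : infimums S m -> infimums S n -> m = n.
Proof. exact: is_subset1_infimums. Qed.

Lemma supremums_unique S m n : supremums S m -> supremums S n -> m = n.
Proof. exact: is_subset1_supremums. Qed.

Lemma meet_semilatticeP : (exists t : T, is_top t) ->
  (forall a b, exists m, infimums [set a; b] m) -> @meet_semilattice _ T.
Proof.
move=> [t tT] meetT S Sf.
elim/finite_set_ind: S / Sf; first by exists t; apply/infimums0P.
move=> a S _ [n Sn]; have [m anm] := meetT a n.
by exists m; apply/(infimumsU1 _ _ Sn).
Qed.

(** The definition of [is_imp] asks for some meet lying below [b]. When binary meets exist they are
    unique, so any given meet can be tested instead. *)
Lemma is_impP a b c : @meet_semilattice _ T ->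
  is_imp a b c <-> forall x m, infimums [set a; x] m -> x <= c = (m <= b).
Proof.
move=> meetT; split=> [abc x m axm|abc x].
  apply/idP/idP => [/abc[n axn]|mb]; first by rewrite (infimums_unique axm axn).
  by apply/abc; exists m.
have [m axm] := meetT _ (finite_set2 a x).
rewrite (abc _ _ axm); split=> [|[n axn]]; first by exists m.
by rewrite (infimums_unique axm axn).
Qed.

End order_basics.

Lemma preserves_finite_meetsP d d' (A : porderType d) (B : porderType d')
    (h : A -> B) : @meet_semilattice _ A ->
  (forall t, is_top t -> is_top (h t)) ->
  (forall a b m, infimums [set a; b] m -> infimums [set h a; h b] (h m)) ->
  preserves_finite_meets h.
Proof.
move=> meetA htop hmeet S m Sf.
elim/finite_set_ind: S / Sf m => [m /infimums0P/htop|a S Sf IHS m].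
  by rewrite image_set0 infimums0P.
have [n Sn] := meetA _ Sf; move=> /(infimumsU1 _ _ Sn)/hmeet.
by rewrite image_setU image_set1 -(infimumsU1 _ _ (IHS _ Sn)).
Qed.

Section preserves_meets.
Context {d d' : Order.disp_t} {A : porderType d} {B : porderType d'}.
Variable h : A -> B.
Hypothesis hmeets : preserves_finite_meets h.

Lemma preserves_top t : is_top t -> is_top (h t).
Proof.
move=> /infimums0P/(hmeets (finite_set0 _)).
by rewrite image_set0 => /infimums0P.
Qed.

Lemma preserves_meet a b m :
  infimums [set a; b] m -> infimums [set h a; h b] (h m).
Proof.
by move=> /(hmeets (finite_set2 a b)); rewrite image_setU !image_set1.
Qed.

Lemma preserves_meets_le a b : a <= b -> h a <= h b.
Proof.
by move=> /infimums_ge/preserves_meet/infimums2P/(_ (h a));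
  rewrite lexx => /esym/andP[].
Qed.

End preserves_meets.

Lemma preserves_join d d' (A : porderType d) (B : porderType d') (h : A -> B)
    a b m : preserves_finite_joins h ->
  supremums [set a; b] m -> supremums [set h a; h b] (h m).
Proof.
by move=> hjoins /(hjoins _ _ (finite_set2 a b));
  rewrite image_setU !image_set1.
Qed.

(** * Transport of frames, compact elements and implications along order isomorphisms *)

Section order_isomorphism.
Context {d d' : Order.disp_t} {A : porderType d} {B : porderType d'}.
Variables (f : A -> B) (g : B -> A).
Hypotheses (fK : cancel f g) (gK : cancel g f) (fle : {mono f : x y / x <= y}).

Lemma can_mono_le : {mono g : x y / x <= y}.
Proof. by move=> x y; rewrite -fle !gK. Qed.

Lemma image_canK (S : set B) : f @` (g @` S) = S.
Proof.
by rewrite image_comp; under eq_imagel do rewrite /= gK; rewrite image_id.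
Qed.

Lemma can_le x y : f x <= y = (x <= g y).
Proof. by rewrite -{1}(gK y) fle. Qed.

Lemma le_can x y : y <= f x = (g y <= x).
Proof. by rewrite -{1}(gK y) fle. Qed.

Lemma iso_infimums S m : infimums (f @` S) (f m) <-> infimums S m.
Proof.
rewrite !infimumsP; split=> mP x.
  rewrite -fle mP; split=> [xS s Ss|xS _ [s Ss <-]]; last by rewrite fle xS.
  by rewrite -fle; apply: xS; exists s.
rewrite le_can mP; split=> [xS _ [s /xS ? <-]|xS s Ss]; first by rewrite le_can.
by rewrite -le_can; apply: xS; exists s.
Qed.

Lemma iso_supremums S m : supremums (f @` S) (f m) <-> supremums S m.
Proof.
rewrite !supremumsP; split=> mP x.
  rewrite -fle mP; split=> [xS s Ss|xS _ [s Ss <-]]; last by rewrite fle xS.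
  by rewrite -fle; apply: xS; exists s.
rewrite can_le mP; split=> [xS _ [s /xS ? <-]|xS s Ss]; first by rewrite can_le.
by rewrite -can_le; apply: xS; exists s.
Qed.

Lemma iso_infimums2 a b m :
  infimums [set f a; f b] (f m) <-> infimums [set a; b] m.
Proof. by rewrite -iso_infimums image_setU !image_set1. Qed.

Lemma iso_is_imp a b c : is_imp a b c -> is_imp (f a) (f b) (f c).
Proof.
move=> abc x; rewrite le_can abc; split=> -[m axm mb].
  by exists (f m); rewrite ?fle // -[x]gK iso_infimums2.
exists (g m); last by rewrite -le_can.
by rewrite -iso_infimums2 !gK.
Qed.

End order_isomorphism.

Section order_isomorphism_transport.
Context {d d' : Order.disp_t} {A : porderType d} {B : porderType d'}.
Variables (f : A -> B) (g : B -> A).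
Hypotheses (fK : cancel f g) (gK : cancel g f) (fle : {mono f : x y / x <= y}).
Let gle := can_mono_le gK fle.

Lemma iso_way_below a b : way_below a b -> way_below (f a) (f b).
Proof.
move=> ab S s /(iso_supremums fK gle) Ss; rewrite (can_le gK fle).
move=> /(ab _ _ Ss)[F [t [FS Ff Ft at_]]].
exists (f @` F), (f t); split; rewrite ?fle //.
- by move=> _ [x /FS[y Sy <-] <-]; rewrite gK.
- exact: finite_image.
- exact/(iso_supremums gK fle).
Qed.

Lemma iso_compact_elt k : compact_elt k -> compact_elt (f k).
Proof. exact: iso_way_below. Qed.

Lemma iso_meet_semilattice : @meet_semilattice _ A -> @meet_semilattice _ B.
Proof.
move=> meetA S Sf; have [m Sm] := meetA _ (finite_image g Sf).
by exists (f m); rewrite -(image_canK gK S) iso_infimums.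
Qed.

Lemma iso_brouwerian_semilattice :
  @brouwerian_semilattice _ A -> @brouwerian_semilattice _ B.
Proof.
move=> [meetA impA]; split; first exact: iso_meet_semilattice.
move=> a b; have [c abc] := impA (g a) (g b).
by exists (f c); rewrite -(gK a) -(gK b); exact: (iso_is_imp gK fle).
Qed.

Lemma iso_frame : @frame _ A -> @frame _ B.
Proof.
move=> [supA distrA]; split=> [S|a S s m].
  have [s Ss] := supA (g @` S).
  by exists (f s); rewrite -(image_canK gK S) iso_supremums.
rewrite -(iso_supremums fK gle) -(iso_infimums2 fK gle) => Ss asm.
rewrite -(iso_supremums fK gle).
have := distrA _ _ _ _ Ss asm; congr (supremums _ _); apply/seteqP; split=> x.
  move=> [_ [t St <-] atx]; exists (f x); last by rewrite fK.
  by exists t => //; rewrite -(iso_infimums2 fK gle) fK.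
by move=> [y [t St aty] <-]; exists (g t);
  [exists t|rewrite (iso_infimums2 fK gle)].
Qed.

Lemma iso_algebraic_frame : @algebraic_frame _ A -> @algebraic_frame _ B.
Proof.
move=> [frA algA]; split=> [|x]; first exact: iso_frame.
have [S Sc Sx] := algA (g x); exists (f @` S).
  by move=> _ [y /Sc yc <-]; exact: iso_compact_elt.
by rewrite -(gK x) (iso_supremums gK fle).
Qed.

End order_isomorphism_transport.

Section arithmetic_frame_transport.
Context {d d' : Order.disp_t} {A : porderType d} {B : porderType d'}.
Variables (f : A -> B) (g : B -> A).
Hypotheses (fK : cancel f g) (gK : cancel g f) (fle : {mono f : x y / x <= y}).
Let gle := can_mono_le gK fle.

Lemma iso_arithmetic_frame : @arithmetic_frame _ A -> @arithmetic_frame _ B.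
Proof.
move=> [algA meetA]; split; first exact: (iso_algebraic_frame fK gK fle).
move=> k l m kc lc; rewrite -(iso_infimums2 fK gle) => klm.
rewrite -(gK m); apply: (iso_compact_elt fK gK fle).
by apply: meetA klm; exact: (iso_compact_elt gK fK gle).
Qed.

End arithmetic_frame_transport.

(** Built from preservation of compact elements alone, so that it serves both order isomorphisms and
    frame morphisms. *)
Definition compacts_map (L M : poset) (f : L -> M)
    (fc : forall k, compact_elt k -> compact_elt (f k)) (k : compacts L) :
    compacts M :=
  Sub (f (val k)) (asboolT (fc _ (asboolW (valP k)))).

Section frame_isomorphism.
Variables (L M : poset) (f : L -> M) (g : M -> L).
Hypotheses (fK : cancel f g) (gK : cancel g f) (fle : {mono f : x y / x <= y}).
Let gle := can_mono_le gK fle.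
Let fc := iso_compact_elt fK gK fle.
Let gc := iso_compact_elt gK fK gle.

Let cf : compacts_dual L -> compacts_dual M := compacts_map fc.
Let cg : compacts_dual M -> compacts_dual L := compacts_map gc.

Let cfK : cancel cf cg.
Proof. by move=> k; apply: val_inj; rewrite /= fK. Qed.

Let cgK : cancel cg cf.
Proof. by move=> k; apply: val_inj; rewrite /= gK. Qed.

Let cfle : {mono cf : x y / x <= y}.
Proof. by move=> x y; exact: fle. Qed.

(** Lets the closed upsets of a space inherit their frame structure from a filter frame, where it is
    proved once. *)
Lemma iso_brwArFrm_obj : @is_obj BrwArFrm L -> @is_obj BrwArFrm M.
Proof.
move=> [arL [algL brwL]]; split; first exact: (iso_arithmetic_frame fK gK fle).
split; first exact: (iso_algebraic_frame fK gK fle).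
exact: (iso_brouwerian_semilattice cgK cfle).
Qed.

Lemma iso_brwArFrm_mor : brwArFrm_mor f.
Proof.
split=> [S s|S m _|k|a b c a' b' c'].
- by rewrite (iso_supremums gK fle).
- by rewrite (iso_infimums gK fle).
- exact: fc.
move=> ea eb ec /(iso_is_imp cgK cfle).
by congr is_imp; apply: val_inj; rewrite ?ea ?eb ?ec.
Qed.

End frame_isomorphism.

(** * Filters of a Brouwerian algebra *)

Lemma leFP (A : poset) (F G : filters A) : F <= G <-> val F `<=` val G.
Proof. by rewrite leEsub -subsetEset. Qed.

Lemma up_closureP d (A : porderType d) (a : A) : is_filter (up_closure [set a]).
Proof.
split; first by exists a, a.
- by move=> x y [_ ->] ax xy; exists a => //; exact: le_trans xy.
- move=> x y m [_ -> ax] [_ -> ay] /infimums2P xym.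
  by exists a; rewrite // xym ax.
Qed.

Definition principal (A : poset) (a : A) : filters A :=
  Sub (up_closure [set a]) (asboolT (up_closureP a)).

Lemma in_principal (A : poset) (a x : A) :
  val (principal a) x = (a <= x) :> Prop.
Proof. by apply/propext; split=> [[_ ->]|ax] //; exists a. Qed.

Lemma principal_le (A : poset) (a : A) (F : filters A) :
  principal a <= F <-> val F a.
Proof.
rewrite leFP; split=> [|Fa x]; first by apply; rewrite in_principal.
rewrite in_principal => ax; have [_ Fup _] := asboolW (valP F); exact: Fup ax.
Qed.

(** Larger elements generate smaller filters; the order dual in [compacts_dual] undoes this
    reversal. *)
Lemma principal_mono (A : poset) (a b : A) :
  (principal b <= principal a) = (a <= b).
Proof. by apply/idP/idP; rewrite principal_le in_principal. Qed.

Section brouwerian_operations.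
Variable A : poset.
Implicit Types (a b c x : A) (F : set A).

(** Lattice operations are given only as relations on a bare poset; [xget] selects a value. The
    default [a] is returned only when there is none, which [brwA] excludes. *)
Definition bmeet a b := xget a (infimums [set a; b]).
Definition bjoin a b := xget a (supremums [set a; b]).
Definition bimp a b := xget a [set c | is_imp a b c].

Hypothesis brwA : @brouwerian_algebra _ A.

Lemma bmeet_inf a b : infimums [set a; b] (bmeet a b).
Proof.
have [[meetA _] _] := brwA; have [m abm] := meetA _ (finite_set2 a b).
by apply: xgetPex; exists m.
Qed.

Lemma bjoin_sup a b : supremums [set a; b] (bjoin a b).
Proof. by have [_ joinA] := brwA; have [m abm] := joinA a b; apply: xgetPex;
  exists m. Qed.

Lemma bimp_imp a b : is_imp a b (bimp a b).
Proof.
by have [[_ impA] _] := brwA; have [c abc] := impA a b; apply: xgetPex;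
  exists c.
Qed.

Lemma le_bmeet x a b : x <= bmeet a b = (x <= a) && (x <= b).
Proof. by move: x; apply/infimums2P/bmeet_inf. Qed.

Lemma bjoin_le x a b : bjoin a b <= x = (a <= x) && (b <= x).
Proof. by move: x; apply/supremums2P/bjoin_sup. Qed.

Lemma le_bimp x a b : x <= bimp a b = (bmeet a x <= b).
Proof.
apply: (is_impP _ _ _ _).1;
  [by have [[]] := brwA|exact: bimp_imp|exact: bmeet_inf].
Qed.

Lemma infimums_bmeet a b m : infimums [set a; b] m <-> m = bmeet a b.
Proof.
split=> [abm|->]; last exact: bmeet_inf.
by apply: infimums_unique abm _; exact: bmeet_inf.
Qed.

Lemma supremums_bjoin a b m : supremums [set a; b] m <-> m = bjoin a b.
Proof.
split=> [abm|->]; last exact: bjoin_sup.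
by apply: supremums_unique abm _; exact: bjoin_sup.
Qed.

Lemma is_imp_bimp a b c : is_imp a b c <-> c = bimp a b.
Proof.
split=> [abc|->]; last exact: bimp_imp.
have [[meetA _] _] := brwA; move/(is_impP _ _ _ meetA): abc => abc.
apply/eqP; rewrite eq_le le_bimp -(abc c _ (bmeet_inf a c)) lexx.
by rewrite (abc _ _ (bmeet_inf a (bimp a b))) -le_bimp lexx.
Qed.

Lemma brw_top : exists t : A, is_top t.
Proof. by have [[/(_ _ (finite_set0 _))[t /infimums0P]]] := brwA; exists t. Qed.

Lemma bmeetl a b : bmeet a b <= a.
Proof. by have := lexx (bmeet a b); rewrite le_bmeet => /andP[]. Qed.

Lemma bmeetr a b : bmeet a b <= b.
Proof. by have := lexx (bmeet a b); rewrite le_bmeet => /andP[]. Qed.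

Lemma bjoinl a b : a <= bjoin a b.
Proof. by have := lexx (bjoin a b); rewrite bjoin_le => /andP[]. Qed.

Lemma bjoinr a b : b <= bjoin a b.
Proof. by have := lexx (bjoin a b); rewrite bjoin_le => /andP[]. Qed.

(** Distributivity by residuation: the hypotheses place [a] and [b] below [bimp c x], hence also
    their join. *)
Lemma bmeet_joinr a b c x :
  bmeet c a <= x -> bmeet c b <= x -> bmeet c (bjoin a b) <= x.
Proof. by rewrite -!le_bimp bjoin_le => -> ->. Qed.

Lemma is_filterP F : is_filter F <->
  [/\ F !=set0, is_upset F & forall a b, F a -> F b -> F (bmeet a b)].
Proof.
split=> -[F0 Fup Fm]; split=> //; first by move=> a b Fa Fb;
  exact: Fm (bmeet_inf a b).
by move=> a b m Fa Fb /infimums_bmeet ->; exact: Fm.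
Qed.

Lemma filter_bmeet F a b : is_filter F -> F (bmeet a b) <-> F a /\ F b.
Proof.
move=> /is_filterP[F0 Fup Fm]; split=> [Fab|[]]; last exact: Fm.
by split; apply: Fup Fab _; rewrite ?bmeetl ?bmeetr.
Qed.

Lemma filter_top F t : is_filter F -> is_top t -> F t.
Proof. by move=> [[x Fx] Fup _] tt; exact: Fup (tt x). Qed.

Lemma is_filterI F G : is_filter F -> is_filter G -> is_filter (F `&` G).
Proof.
move=> fF fG; have [_ Fup Fm] := fF; have [_ Gup Gm] := fG.
have [t tt] := brw_top; split; first by exists t; split; exact: filter_top.
- by move=> x y [Fx Gx] xy; split; [exact: Fup xy|exact: Gup xy].
- by move=> a b m [Fa Ga] [Fb Gb] abm; split; [exact: Fm abm|exact: Gm abm].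
Qed.

Lemma filter_infimums (F G M : filters A) :
  infimums [set F; G] M <-> val M = val F `&` val G.
Proof.
have FGP : `[< is_filter (val F `&` val G) >].
  by apply/asboolP/is_filterI; apply/asboolP; [exact: (valP F)|exact: (valP G)].
pose FG : filters A := Sub (val F `&` val G) FGP.
have FGinf : infimums [set F; G] FG.
  apply/infimums2P => x; apply/idP/andP => [/leFP xFG|[/leFP xF /leFP xG]].
    by split; apply/leFP => a /xFG[].
  by apply/leFP => a xa; split; [exact: xF|exact: xG].
split=> [/(infimums_unique FGinf) <-//|MFG].
by have -> : M = FG by exact: val_inj.
Qed.

(** Properness is left out on purpose: the improper filter qualifies, and it becomes the maximum of
    the dual space. *)
Definition join_prime F := forall a b, F (bjoin a b) -> F a \/ F b.

(** Meet-primeness in the filter frame can be tested on principal filters, because two of them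
    intersect in the principal filter of the join. Conversely, if two filters both fail to lie below
    [F], the join of two witnesses belongs to their intersection but not to [F]. *)
Lemma prime_filterP F :
  prime_filter F <-> [/\ is_filter F, F <> setT & join_prime F].
Proof.
split.
  move=> [Q <- [Qtop Qprime]]; split; first exact: (asboolW (valP Q)).
    by move=> QT; apply: Qtop => G; apply/leFP; rewrite QT.
  move=> a b Qab; rewrite -!principal_le.
  have PP : `[< is_filter (val (principal a) `&` val (principal b)) >].
    by apply/asboolP/is_filterI; apply: up_closureP.
  apply: (Qprime _ _ (Sub (val (principal a) `&` val (principal b)) PP));
    first exact/filter_infimums.
  apply/leFP => x; rewrite SubK => -[]; rewrite !in_principal => ax bx;
    have [_ Qup _] := asboolW (valP Q).
  by apply: Qup Qab _; rewrite bjoin_le ax bx.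
move=> [fF FT Fprime]; exists (Sub F (asboolT fF)) => //; split.
  move=> Ftop; apply: FT; apply/seteqP; split=> // a _.
  by have := Ftop (principal a); rewrite principal_le.
move=> G H M /filter_infimums eM /leFP; rewrite eM SubK => GHF.
apply: contrapT => /not_orP[/leFP/existsNP[a /not_implyP[Ga Fa]]].
move=> /leFP/existsNP[b /not_implyP[Hb Fb]].
have [|/Fa|/Fb]// := Fprime a b; apply: GHF; split.
  by have [_ Gup _] := asboolW (valP G); apply: Gup Ga (bjoinl a b).
by have [_ Hup _] := asboolW (valP H); apply: Hup Hb (bjoinr a b).
Qed.

(** Optimality for the pair [a], [b] and [c] their join is exactly primeness. Conversely, the
    complement of a proper join-prime filter is directed and nonempty, so it contains an upper bound
    [y] of [S]; then [c <= y], and [c] cannot be in [F]. This also settles the empty [S]. *)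
Lemma optimalsP F : optimal F \/ F = setT <-> is_filter F /\ join_prime F.
Proof.
split=> [[[fF Fopt]|->]|[fF Fprime]].
- split=> // a b Fab; apply: contrapT => /not_orP[Fa Fb].
  apply: (Fopt [set a; b] (bjoin a b) (finite_set2 a b) _ _ Fab) =>
    [c [] ->|x abx] //.
  exists (bjoin a b) => //; rewrite bjoin_le.
  have [|_ -> ->] := abx a; first by left.
  by have [|_ -> ->] := abx b; first by right.
- split; last by left.
  by have [t _] := brw_top; split=> //; exists t.
have [->|FT] := pselect (F = setT); [by right|left; split=> // S c Sf SF Sc Fc].
have [x Fx] : exists x, ~ F x.
  by apply/existsNP => FA; apply: FT; apply/seteqP; split.
have [|||y Fy Sy] := @finite_set_bound _ <=%O (~` F) S _ _ _ Sf SF.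
- by move=> ? ? ?; exact: le_trans.
- by exists x.
- move=> a b Fa Fb; exists (bjoin a b); rewrite bjoinl bjoinr; split=> //.
  by case/Fprime.
have [|_ -> cy] := Sc y; first by move=> a /Sy; exists a.
by apply: Fy; have [_ Fup _] := fF; exact: Fup cy.
Qed.

(** A filter maximal among those containing [F] and missing [I] is join-prime. If it omits [a] and
    [b], then [p], [q] in it satisfy that the meet of [p] and [a] is below some [i] in [I], and that
    of [q] and [b] below some [j] in [I]. By distributivity the meet of [p], [q] and the join of [a]
    and [b] is below a common bound of [i] and [j] in [I]. Only directedness of [I] is asked, so
    that the image of the complement of a prime filter can be used. *)
Lemma prime_separation F (I : set A) : is_filter F ->
  (forall a b, I a -> I b -> exists c, [/\ I c, a <= c & b <= c]) ->
  (forall a, F a -> ~ I a) ->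
  exists P, [/\ is_filter P, join_prime P, F `<=` P & forall a, P a -> ~ I a].
Proof.
move=> fF dirI FI.
pose good := [set G : set A | [/\ is_filter G, F `<=` G & forall a, G a -> ~ I
  a]].
(* The set [set0] is adjoined because the empty chain has empty union; it cannot be maximal, since
   [F] is a good set strictly above it. *)
have [C CG Ctot|P [[->|[fP FP PI]] Pmax]] :=
  @Zorn_bigcup A ([set set0] `|` good).
- have [[G CG0 gG]|Cgood] := pselect (exists2 G, C G & good G); last first.
    left; apply/seteqP; split=> // a [G CG1 Ga].
    by have [G0|gG] := CG _ CG1; [rewrite -G0|case: Cgood; exists G].
  have gC H a : C H -> H a -> good H.
    by move=> CH Ha; have [H0|//] := CG _ CH; move: Ha; rewrite H0.
  right; split.
  + split.
    * by have [[[x Gx] _ _] _ _] := gG; exists x, G.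
    * move=> x y [H CH Hx] xy; exists H => //.
      by have [[_ Hup _] _ _] := gC _ _ CH Hx; exact: Hup xy.
    * move=> a b m [H CH Ha] [K CK Kb] abm.
      have [HK|KH] := Ctot _ _ CH CK.
        by exists K => //; have [[_ _ Km] _ _] := gC _ _ CK Kb;
          apply: Km abm => //; exact: HK.
      by exists H => //; have [[_ _ Hm] _ _] := gC _ _ CH Ha;
        apply: Hm abm => //; exact: KH.
  + by have [_ FG _] := gG; move=> a /FG Ga; exists G.
  + by move=> a [H CH Ha]; have [_ _] := gC _ _ CH Ha; apply.
- exfalso; apply: (Pmax F); last by right; split.
  have [[x Fx] _ _] := fF.
  by split=> // /(_ x Fx).
exists P; split=> // a b Pab; apply: contrapT => /not_orP[Pa Pb].
have extend c : ~ P c -> exists p i, [/\ P p, I i & bmeet p c <= i].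
  move=> Pc; apply: contrapT => noI.
  (* This is the filter generated by [P] and [c]. It is strictly larger than [P], so by maximality
     it must meet [I]. *)
  pose G := [set x | exists2 p, P p & bmeet p c <= x].
  have [_ Pup _] := fP; have [[y Py] _ _] := fP.
  apply: (Pmax G); [|right; split].
  - split; first by move=> x Px; exists x => //; exact: bmeetl.
    by move=> GP; apply/Pc/GP; exists y => //; exact: bmeetr.
  - apply/is_filterP; split; first by exists c, y => //; exact: bmeetr.
    + by move=> u v [p Pp pu] uv; exists p => //; exact: le_trans uv.
    + move=> u v [p Pp pu] [q Pq qv]; exists (bmeet p q).
        exact/filter_bmeet.
      rewrite le_bmeet; apply/andP; split;
        [apply: le_trans pu|apply: le_trans qv];
        rewrite le_bmeet bmeetr andbT (le_trans (bmeetl _ _)) //.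
        exact: bmeetl.
      exact: bmeetr.
  - by move=> x /FP Px; exists x => //; exact: bmeetl.
  - by move=> x [p Pp px] Ix; apply: noI; exists p, x.
have [p [i [Pp Ii pai]]] := extend _ Pa;
  have [q [j [Pq Ij qbj]]] := extend _ Pb.
have [k [Ik ik jk]] := dirI _ _ Ii Ij.
apply: (PI k) => //; have [_ Pup _] := fP.
have : P (bmeet (bmeet p q) (bjoin a b)) by apply/filter_bmeet => //;
  split=> //; exact/filter_bmeet.
move=> /Pup; apply; apply: bmeet_joinr; [apply: le_trans ik|apply: le_trans jk].
  apply: le_trans pai; rewrite le_bmeet bmeetr andbT (le_trans (bmeetl _ _)) //.
  exact: bmeetl.
apply: le_trans qbj; rewrite le_bmeet bmeetr andbT (le_trans (bmeetl _ _)) //.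
exact: bmeetr.
Qed.

Lemma prime_separation1 F b : is_filter F -> ~ F b ->
  exists P, [/\ is_filter P, join_prime P, F `<=` P & ~ P b].
Proof.
move=> fF Fb; have [|a Fa ab|P [fP pP FP Pb]] := @prime_separation F [set b] fF.
- by move=> x y -> ->; exists b.
- by apply: Fb; rewrite -ab.
- by exists P; split=> // Pb'; apply: (Pb b).
Qed.

End brouwerian_operations.

(** * The frame of filters *)

Section compact_elements.
Context {d : Order.disp_t} {T : porderType d}.
Implicit Types (S D : set T) (x y k s : T).

(** The finite part of [D] provided by compactness has an upper bound within the directed set
    [D]. *)
Lemma compact_directed k D s : compact_elt k -> supremums D s -> k <= s ->
  D !=set0 -> (forall x y, D x -> D y -> exists z, [/\ D z, x <= z & y <= z]) ->
  exists2 x, D x & k <= x.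
Proof.
move=> kc Ds /(kc _ _ Ds)[F [t [FD Ff Ft kt]]] D0 dirD.
have [|x Dx Fx] := finite_set_bound _ D0 dirD Ff FD.
  by move=> ? ? ?; exact: le_trans.
by exists x => //; apply: le_trans kt _; move/supremumsP: Ft => /(_ x) ->.
Qed.

Lemma supremums_subset S S' s s' :
  S `<=` S' -> supremums S s -> supremums S' s' -> s <= s'.
Proof.
move=> SS' /supremumsP Ss [S's' _]; apply/Ss => x /SS'; exact: S's'.
Qed.

Hypothesis supT : forall S, supremums S !=set0.

Lemma frame_infimums S : infimums S !=set0.
Proof.
have [m Sm] := supT (lbound S); exists m; move/supremumsP: Sm => mP.
apply/infimumsP => x; split=> [xm s Ss|xS]; last exact: (mP m).1.
by apply: le_trans xm _; apply/mP => y; exact.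
Qed.

Lemma compact_supremums S s :
  finite_set S -> S `<=` compact_elt -> supremums S s -> compact_elt s.
Proof.
move=> Sf; elim/finite_set_ind: S / Sf s =>
  [s _ /supremumsP s0|a S _ IHS s aSc].
  move=> S' s' _ _; have [t t0] := supT set0.
  by exists set0, t; split=> //; apply/s0.
move=> /supremumsP sP; have [s0 Ss0] := supT S.
have s0c : compact_elt s0 by apply: IHS => // x Sx; apply: aSc; right.
have ac : compact_elt a by apply: aSc; left.
have [a_s s0s] : a <= s /\ s0 <= s.
  have sS := (sP s).1 (lexx s); split; first by apply: sS; left.
  by move/supremumsP: Ss0 => ->  x Sx; apply: sS; right.
move=> S' s' S's' ss'.
have [F1 [t1 [F1S F1f F1t at1]]] := ac _ _ S's' (le_trans a_s ss').
have [F2 [t2 [F2S F2f F2t st2]]] := s0c _ _ S's' (le_trans s0s ss').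
have [t Ft] := supT (F1 `|` F2); exists (F1 `|` F2), t; split=> //.
- by move=> x [/F1S|/F2S].
- by rewrite finite_setU.
apply/sP => x [->|Sx].
  by apply: le_trans at1 (supremums_subset _ F1t Ft) => y; left.
apply: le_trans (supremums_subset _ F2t Ft); last by move=> y; right.
by apply: le_trans st2; move: Sx; case: Ss0 => + _; apply.
Qed.

End compact_elements.

Lemma algebraic_le d (T : porderType d) (x y : T) : @algebraic_frame _ T ->
  (forall k, compact_elt k -> k <= x -> k <= y) -> x <= y.
Proof.
move=> [_ algT] xy; have [S Sc [Sx xS]] := algT x.
by apply: xS => k Sk; apply: xy; [exact: Sc|exact: Sx].
Qed.

Section filter_frame.
Variable A : poset.
Hypothesis brwA : @brouwerian_algebra _ A.
Implicit Types (a b : A) (E F G H M : filters A).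

Let filterW F : is_filter (val F) := asboolW (valP F).

Lemma is_top_filter F : is_top F <-> val F = setT.
Proof.
split=> [Ftop|FT G]; last by apply/leFP; rewrite FT.
by apply/seteqP; split=> // a _; have := Ftop (principal a);
  rewrite principal_le.
Qed.

(** The join is built from above, as the intersection of all filters that bound [S]; the top element
    makes it nonempty. *)
Lemma filter_supremums (S : set (filters A)) : supremums S !=set0.
Proof.
pose G := \bigcap_(F in ubound S) val F.
have fG : is_filter G.
  have [t tt] := brw_top brwA; split.
  - by exists t => F _; exact: filter_top.
  - by move=> x y Gx xy F SF; have [_ Fup _] := filterW F; apply: Fup xy;
    exact: Gx.
  - move=> a b m Ga Gb abm F SF; have [_ _ Fm] := filterW F.
    by apply: Fm abm; [exact: Ga|exact: Gb].
exists (Sub G (asboolT fG)); split=> [F SF|F SF]; apply/leFP; rewrite SubK.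
  by move=> a Fa H /(_ F SF)/leFP; exact.
by move=> a; exact.
Qed.

Lemma filter_meet_semilattice : @meet_semilattice _ (filters A).
Proof. by move=> S _; apply: frame_infimums; exact: filter_supremums. Qed.

Lemma bjoin_meet_le a b c :
  bmeet (bjoin a b) (bjoin a c) <= bjoin a (bmeet b c).
Proof.
have comm (x y : A) : bmeet x y <= bmeet y x by rewrite le_bmeet//;
  apply/andP; split; [exact: bmeetr|exact: bmeetl].
apply: bmeet_joinr => //; first by apply: le_trans (bmeetr _ _ _) (bjoinl _ _
  _).
apply: le_trans (comm _ _) _; apply: bmeet_joinr => //.
  by apply: le_trans (bmeetr _ _ _) (bjoinl _ _ _).
by apply: le_trans (comm _ _) (bjoinr _ _ _).
Qed.

(* The relative pseudocomplement in the frame of filters: its existence makes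
   binary meets distribute over arbitrary joins. *)
Lemma filter_imp F H : exists G, forall E, E <= G <-> val E `&` val F `<=` val
  H.
Proof.
have [_ Hup Hm] := filterW H; have [_ Fup _] := filterW F.
(* The condition says that the principal filter of [b] meets [F] inside [H], since principal filters
   intersect in the one generated by the join. *)
pose G := [set b | forall a, val F a -> val H (bjoin a b)].
have fG : is_filter G.
  apply/is_filterP => //; split.
  - have [t tt] := brw_top brwA; exists t => a _.
    by apply: (Hup t); [exact: filter_top|exact: bjoinr].
  - move=> x y Gx xy a Fa; apply: Hup (Gx _ Fa) _.
    by rewrite bjoin_le// bjoinl//= (le_trans xy)// bjoinr.
  - move=> b c Gb Gc a Fa; apply: Hup (bjoin_meet_le a b c).
    by apply/filter_bmeet => //; split; [exact: Gb|exact: Gc].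
exists (Sub G (asboolT fG)) => E; rewrite leFP SubK;
  split=> [EG b [Eb Fb]|EFH b Eb a Fa].
  by apply: Hup (EG _ Eb _ Fb) _; rewrite bjoin_le// lexx.
have [_ Eup _] := filterW E.
by apply: EFH; split; [apply: Eup Eb _; exact: bjoinr|apply: Fup Fa _;
  exact: bjoinl].
Qed.

Lemma filter_frame : @frame _ (filters A).
Proof.
split=> [|F S s M Ss]; first exact: filter_supremums.
move=> FsM; have eM : val M = val F `&` val s by apply/filter_infimums.
apply/supremumsP => H; have [G GP] := filter_imp F H.
have -> : (M <= H) = (s <= G) :> Prop.
  have MH : M <= H <-> val F `&` val s `<=` val H by rewrite -eM; exact: leFP.
  apply/propext; split=> [/MH FsH|sG].
    by apply/GP => x [sx Fx]; exact: FsH.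
  by apply/MH => x [Fx sx]; exact: (GP s).1 sG x (conj sx Fx).
move/supremumsP: Ss => ->; split=> [SG x [t St /(filter_infimums brwA) ex]|SH t
  St].
  by apply/leFP; rewrite ex setIC; apply/GP/SG.
have [m Ftm] := filter_meet_semilattice (finite_set2 F t).
apply/GP; have /leFP := SH m (ex_intro2 _ _ t St Ftm).
by move/(filter_infimums brwA): Ftm => ->; rewrite setIC.
Qed.

Lemma filter_sup_principal F : supremums (@principal A @` val F) F.
Proof.
apply/supremumsP => G; split=> [/leFP FG _ [a Fa <-]|FG].
  by apply/principal_le/FG.
by apply/leFP => a Fa; apply/principal_le/FG; exists a.
Qed.

(** The union of the joins of finite subfamilies of [S] is already a filter, so it contains [s].
    Hence [a] lies in one of these finite joins. *)
Lemma principal_compact a : compact_elt (principal a).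
Proof.
move=> S s Ss /principal_le sa.
pose G := [set b | exists T t, [/\ T `<=` S, finite_set T, supremums T t & val
  t b]].
suff fG : is_filter G.
  have : s <= Sub G (asboolT fG).
    move/supremumsP: Ss => -> F SF; apply/leFP; rewrite SubK => b Fb.
    exists [set F], F; split=> //; first by move=> _ ->.
    by rewrite supremums1.
  move/leFP; rewrite SubK => /(_ _ sa)[T [t [TS Tf Tt ta]]].
  by exists T, t; split=> //; apply/principal_le.
have [u ut] := brw_top brwA; split.
- have [t Tt] := filter_supremums set0.
  by exists u, set0, t; split=> //; exact: filter_top.
- move=> x y [T [t [TS Tf Tt tx]]] xy; exists T, t; split=> //.
  by have [_ tup _] := filterW t; exact: tup xy.
- move=> b c m [T [t [TS Tf Tt tb]]] [T' [t' [TS' Tf' Tt' tc]]] bcm.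
  have [w Tw] := filter_supremums (T `|` T').
  exists (T `|` T'), w; split=> //.
  + by move=> x [/TS|/TS'].
  + by rewrite finite_setU.
  have [_ _ wm] := filterW w; apply: wm bcm.
    by have /leFP := supremums_subset (@subsetUl _ T T') Tt Tw; exact.
  by have /leFP := supremums_subset (@subsetUr _ T T') Tt' Tw; exact.
Qed.

(** Every filter is the directed join of the principal filters of its members; a compact one is
    therefore below, and so equal to, one of them. *)
Lemma compact_principal F : compact_elt F -> exists a, F = principal a.
Proof.
move=> Fc; have [[x Fx] _ _] := filterW F.
have [||_ [a Fa <-] aF] := compact_directed Fc (filter_sup_principal F) (lexx
  F).
- by exists (principal x), x.
- move=> _ _ [a Fa <-] [b Fb <-]; exists (principal (bmeet a b)); split.
  + by exists (bmeet a b) => //; exact/filter_bmeet.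
  + by rewrite principal_mono bmeetl.
  + by rewrite principal_mono bmeetr.
by exists a; apply/eqP; rewrite eq_le aF; apply/principal_le.
Qed.

Lemma principal_infimums a b M :
  infimums [set principal a; principal b] M <-> M = principal (bjoin a b).
Proof.
have eab : val (principal (bjoin a b)) = val (principal a) `&` val (principal
  b).
  apply/seteqP; split=> x; rewrite in_principal bjoin_le//.
    by move=> /andP[ax bx]; split; rewrite in_principal.
  by move=> []; rewrite !in_principal => -> ->.
by rewrite filter_infimums// -eab; split=> [/val_inj|->].
Qed.

Definition compact_principal_elt a : compacts_dual (Poset (filters A)) :=
  Sub (principal a) (asboolT (@principal_compact a)) :
    compacts (Poset (filters A)).

Definition generator (K : compacts_dual (Poset (filters A))) : A :=
  sval (boolp.cid (compact_principal (asboolW (valP (K : compacts _))))).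

Lemma compact_principal_mono : {mono compact_principal_elt : a b / a <= b}.
Proof. by move=> a b; exact: principal_mono. Qed.

Lemma generatorK : cancel generator compact_principal_elt.
Proof. by move=> K; apply: val_inj; rewrite /= /generator; case: boolp.cid. Qed.

Lemma compact_principalK : cancel compact_principal_elt generator.
Proof.
by move=> a; apply/eqP; rewrite eq_le -!compact_principal_mono generatorK lexx.
Qed.

Lemma filter_brwArFrm : @is_obj BrwArFrm (Poset (filters A)).
Proof.
have algF : @algebraic_frame _ (filters A).
  split=> [|F]; first exact: filter_frame.
  exists (@principal A @` val F); last exact: filter_sup_principal.
  by move=> _ [a _ <-]; exact: principal_compact.
split; first split=> // K L M /compact_principal[a ->] /compact_principal[b ->].
  by move=> /principal_infimums ->; exact: principal_compact.
split=> //; have [brwA' _] := brwA.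
exact: iso_brouwerian_semilattice generatorK compact_principal_mono brwA'.
Qed.

End filter_frame.

(** * Natural isomorphisms and the functor F *)

Lemma naturally_isomorphic_sym (C D : category) (F G : functor C D) :
  naturally_isomorphic F G -> naturally_isomorphic G F.
Proof.
move=> [eta [nat isoE]].
pose inv A := boolp.cid (isoE A).
exists (fun A => sval (inv A)); split=> [A B f|A]; last first.
  by case: (inv A) => g [gE Eg]; exists (eta A).
case: (inv A) => g [gE Eg]; case: (inv B) => g' [g'E Eg'] /=.
rewrite -[LHS]comp_idr -Eg comp_assoc -(comp_assoc _ _ g') -nat.
by rewrite (comp_assoc _ _ g') g'E comp_idl.
Qed.

Lemma naturally_isomorphic_trans (C D : category) (F G H : functor C D) :
  naturally_isomorphic F G -> naturally_isomorphic G H ->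
  naturally_isomorphic F H.
Proof.
move=> [eta [nat iso]] [eta' [nat' iso']].
exists (fun A => comp (eta' A) (eta A)); split=> [A B f|A].
  by rewrite -comp_assoc nat comp_assoc nat' -comp_assoc.
have [g [gE Eg]] := iso A; have [g' [g'E Eg']] := iso' A.
exists (comp g g'); split.
  by rewrite comp_assoc -(comp_assoc _ _ g) g'E comp_idr gE.
by rewrite comp_assoc -(comp_assoc _ _ (eta' A)) Eg comp_idr Eg'.
Qed.

Lemma naturally_isomorphic_compl (C D E : category) (H : functor D E)
    (F G : functor C D) : naturally_isomorphic F G ->
  naturally_isomorphic (comp_functor H F) (comp_functor H G).
Proof.
move=> [eta [nat iso]]; exists (fun A => fmap H (eta A)); split=> [A B f|A] /=.
  by rewrite -!fmap_comp nat.
have [g [gE Eg]] := iso A.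
by exists (fmap H g); rewrite -!fmap_comp gE Eg !fmap_id.
Qed.

Lemma naturally_isomorphic_compr (B C D : category) (H : functor B C)
    (F G : functor C D) : naturally_isomorphic F G ->
  naturally_isomorphic (comp_functor F H) (comp_functor G H).
Proof.
by move=> [eta [nat iso]]; exists (fun A => eta (H A)); split=> [A A' f|A] /=.
Qed.

(** Components change direction in the opposite category, hence the passage to the inverse
    family. *)
Lemma naturally_isomorphic_op (C D : category) (F G : functor C D) :
  naturally_isomorphic F G ->
  naturally_isomorphic (op_functor F) (op_functor G).
Proof.
move=> /naturally_isomorphic_sym[eta [nat iso]]; exists eta.
split=> [A B f|A] /=; first by rewrite nat.
by have [g [gE Eg]] := iso A; exists g.
Qed.

Lemma naturally_isomorphic_flip (C D : category) (F G : functor (op C) D) :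
  naturally_isomorphic F G ->
  naturally_isomorphic (flip_functor F) (flip_functor G).
Proof.
move=> /naturally_isomorphic_sym[eta [nat iso]]; exists eta.
split=> [A B f|A] /=; first by rewrite (nat B A f).
by have [g [gE Eg]] := iso A; exists g.
Qed.

Section concrete_isomorphism.
Variables (C : category) (D : concrete).

(** Both [eta] and [eps] have to be morphisms: a bijective morphism of a concrete category need not
    be invertible. *)
Lemma concrete_natural_iso (F G : functor C D)
    (eta : forall A, carrier (sval (F A)) -> carrier (sval (G A)))
    (eps : forall A, carrier (sval (G A)) -> carrier (sval (F A))) :
  (forall A, is_mor (eta A)) -> (forall A, is_mor (eps A)) ->
  (forall A, cancel (eta A) (eps A)) -> (forall A, cancel (eps A) (eta A)) ->
  (forall (A B : C) (f : hom A B) x,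
    eta B (sval (fmap F f) x) = sval (fmap G f) (eta A x)) ->
  naturally_isomorphic F G.
Proof.
move=> etaP epsP etaK epsK nat.
exists (fun A => exist _ (eta A) (etaP A)); split=> [A B f|A].
  by apply: chom_eq; apply/funext => x; exact: nat.
exists (exist _ (eps A) (epsP A)).
by split; apply: chom_eq; apply/funext => x; [exact: etaK|exact: epsK].
Qed.

Lemma concrete_natural_iso_op (F G : functor C (op D))
    (eta : forall A, carrier (sval (F A)) -> carrier (sval (G A)))
    (eps : forall A, carrier (sval (G A)) -> carrier (sval (F A))) :
  (forall A, is_mor (eta A)) -> (forall A, is_mor (eps A)) ->
  (forall A, cancel (eta A) (eps A)) -> (forall A, cancel (eps A) (eta A)) ->
  (forall (A B : C) (f : hom A B) x,
    eta A (sval (fmap F f : chom _ _) x) = sval (fmap G f :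
      chom _ _) (eta B x)) ->
  naturally_isomorphic F G.
Proof.
move=> etaP epsP etaK epsK nat; apply: naturally_isomorphic_sym.
exists (fun A => exist _ (eta A) (etaP A)); split=> [A B f|A].
  by apply: chom_eq; apply/funext => x; rewrite /= nat.
exists (exist _ (eps A) (epsP A)).
by split; apply: chom_eq; apply/funext => x; [exact: epsK|exact: etaK].
Qed.

End concrete_isomorphism.

(** * Preimages of prime filters and the frame maps induced by morphisms of algebras *)

Section morphism_preimage.
Variables (A B : poset) (h : A -> B).
Hypotheses (brwA : @brouwerian_algebra _ A) (brwB : @brouwerian_algebra _ B).

Lemma filter_preimage (G : set B) :
  preserves_finite_meets h -> is_filter G -> is_filter (h @^-1` G).
Proof.
move=> hmeets fG; have [_ Gup Gm] := fG; split.
- have [t tt] := brw_top brwA; exists t.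
  by apply: (filter_top fG); exact: (preserves_top hmeets).
- by move=> x y Gx xy; apply: Gup Gx _; exact: preserves_meets_le.
- by move=> a b m Ga Gb /(preserves_meet hmeets); exact: Gm.
Qed.

Lemma join_prime_preimage (G : set B) :
  preserves_finite_joins h -> join_prime G -> join_prime (h @^-1` G).
Proof.
move=> hjoins Gprime a b; rewrite /preimage /=.
have -> : h (bjoin a b) = bjoin (h a) (h b); last exact: Gprime.
by apply/supremums_bjoin => //; apply: preserves_join => //;
  exact/supremums_bjoin.
Qed.

(** Only properness of the preimage can fail. Later verifications of the last clause of [brwAP_mor]
    reduce to finding one [a] with [h a] outside [P]. *)
Lemma prime_filter_preimage (P : set B) :
  preserves_finite_meets h -> preserves_finite_joins h -> prime_filter P ->
  (exists a, ~ P (h a)) -> prime_filter (h @^-1` P).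
Proof.
move=> hmeets hjoins /prime_filterP[]// fP _ Pprime [a Pa].
apply/prime_filterP => //; split;
  [exact: filter_preimage| |exact: join_prime_preimage].
by move=> hPT; apply: Pa; rewrite -[P _]/((h @^-1` P) a) hPT.
Qed.

End morphism_preimage.

Lemma iso_brwAP_mor (A B : poset) (f : A -> B) (g : B -> A) :
  @brouwerian_algebra _ A -> @brouwerian_algebra _ B ->
  cancel f g -> cancel g f -> {mono f : x y / x <= y} -> brwAP_mor f.
Proof.
move=> brwA brwB fK gK fle.
have fmeets : preserves_finite_meets f by move=> S m _; rewrite iso_infimums.
have fjoins : preserves_finite_joins f by move=> S m _; rewrite iso_supremums.
split=> //; first exact: iso_is_imp.
move=> P Pprime; apply: prime_filter_preimage => //.
have /prime_filterP[//|_ PT _] := Pprime; apply/existsNP => PA.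
by apply: PT; apply/seteqP; split=> // b _; rewrite -(gK b).
Qed.

Section filter_morphism.
Variables (A B : poset) (h : A -> B).
Hypotheses (brwA : @brouwerian_algebra _ A) (brwB : @brouwerian_algebra _ B).
Hypothesis hmor : brwAP_mor h.

Let hmeets : preserves_finite_meets h. Proof. by case: hmor. Qed.
Let hjoins : preserves_finite_joins h. Proof. by case: hmor. Qed.

Lemma filter_imageP (F : filters A) : is_filter (up_closure (h @` val F)).
Proof.
have fF := asboolW (valP F); have [[a Fa] _ _] := fF.
apply/is_filterP => //; split.
- by exists (h a), (h a) => //; exists a.
- by move=> x y [z Fz zx] xy; exists z => //; exact: le_trans xy.
- move=> x y [_ [b Fb <-] bx] [_ [c Fc <-] cy]; exists (h (bmeet b c)).
    by exists (bmeet b c) => //; exact/filter_bmeet.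
  have /infimums2P -> := bmeet_inf brwB x y.
  by rewrite (le_trans _ bx) ?(le_trans _ cy)//;
    apply: preserves_meets_le => //;
    [exact: bmeetr|exact: bmeetl].
Qed.

Definition filter_image (F : filters A) : filters B :=
  Sub (up_closure (h @` val F)) (asboolT (filter_imageP F)).

Lemma in_filter_image F b : val (filter_image F) b <-> exists2 a, val F a & h a
  <= b.
Proof. by split=> [[_ [a Fa <-]]|[a Fa ab]]; [exists a|exists (h a) => //;
  exists a]. Qed.

(** The adjunction between image and preimage of filters, from which preservation of joins
    follows. *)
Lemma filter_image_le (F : filters A) (G : filters B) :
  filter_image F <= G <-> val F `<=` h @^-1` val G.
Proof.
rewrite leFP; split=> [FG a Fa|FG b /in_filter_image[a /FG Ga ab]].
  by apply: FG; apply/in_filter_image; exists a.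
by have [_ Gup _] := asboolW (valP G); exact: Gup ab.
Qed.

Lemma filter_image_principal a : filter_image (principal a) = principal (h a).
Proof.
apply/val_inj/seteqP; split=> b; rewrite in_principal in_filter_image.
  by move=> [c]; rewrite in_principal => ac; apply: le_trans;
    exact: preserves_meets_le.
by exists a; rewrite ?in_principal.
Qed.

Lemma filter_image_joins : preserves_joins filter_image.
Proof.
move=> S F SF; apply/supremumsP => G.
pose E : filters A :=
  Sub (h @^-1` val G) (asboolT (filter_preimage brwA hmeets (asboolW (valP
    G)))).
have GE H : filter_image H <= G <-> H <= E by rewrite filter_image_le leFP.
rewrite GE; move/supremumsP: SF => ->; split=> [SE _ [H SH <-]|SG H SH].
  by apply/GE/SE.
by apply/GE/SG; exists H.
Qed.

(* If the image missed [b], separating it from [b] would give a prime filter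
   whose preimage is the improper filter. *)
Lemma filter_image_top (F : filters A) : is_top F -> is_top (filter_image F).
Proof.
move=> /is_top_filter FT; apply/is_top_filter; apply/seteqP; split=> // b _.
apply: contrapT => Fb.
have [P [fP Pprime FP Pb]] := prime_separation1 brwB (filter_imageP F) Fb.
have [PT|PT] := pselect (P = setT); first by apply: Pb; rewrite PT.
have [_ _ _ /(_ P)[|Q eQ [Qtop _]]] := hmor; first exact/prime_filterP.
apply: Qtop; apply/is_top_filter; rewrite eQ; apply/seteqP; split=> // a _.
by apply: FP; exists (h a) => //; exists a; rewrite ?FT.
Qed.

Lemma filter_image_mor :
  @brwArFrm_mor (Poset (filters A)) (Poset (filters B)) filter_image.
Proof.
split; first exact: filter_image_joins.
- apply: preserves_finite_meetsP; first exact: filter_meet_semilattice.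
    exact: filter_image_top.
  move=> F G M /(filter_infimums brwA) eM; apply/filter_infimums => //.
  apply/seteqP; split=> b.
    by move=> /in_filter_image[a]; rewrite eM => -[Fa Ga] ab;
      split; apply/in_filter_image; exists a.
  (* Preservation of binary joins enters here: an element above [h a] and [h c] is above
     [h (bjoin a c)], and [bjoin a c] lies in both filters. *)
  move=> [/in_filter_image[a Fa ab] /in_filter_image[c Gc cb]].
  apply/in_filter_image; exists (bjoin a c); rewrite ?eM.
    have [_ Fup _] := asboolW (valP F); have [_ Gup _] := asboolW (valP G).
    by split; [apply: Fup Fa _; exact: bjoinl|apply: Gup Gc _; exact: bjoinr].
  have /supremums2P -> : supremums [set h a; h c] (h (bjoin a c)).
    by apply: preserves_join => //; exact: bjoin_sup.
  by rewrite ab.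
- move=> k /(compact_principal brwA)[a ->].
  by rewrite filter_image_principal; exact: principal_compact.
move=> a b c a' b' c' ea eb ec.
(* On compact, i.e. principal, filters the frame map is [h] itself, so preservation of implications
   is carried over from [h]. *)
have genE (k : compacts_dual (Poset (filters A)))
    (k' : compacts_dual (Poset (filters B))) :
      compact_val k' = filter_image (compact_val k) ->
    k' = compact_principal_elt brwB (h (generator brwA k)).
  move=> ek; apply: val_inj; rewrite -[LHS]/(compact_val k') ek /=.
  by rewrite -filter_image_principal -[k in LHS](generatorK brwA).
rewrite (genE _ _ ea) (genE _ _ eb) (genE _ _ ec).
move=> /(iso_is_imp (compact_principalK brwA) (can_mono_le (generatorK brwA)
  (compact_principal_mono brwA))).
have [_ himp _ _] := hmor.
by move=> /himp/(iso_is_imp (generatorK brwB) (compact_principal_mono brwB)).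
Qed.

End filter_morphism.

Definition F_restriction : restriction BrwAP BrwArFrm F_obj F_map.
Proof.
refine (@Restriction BrwAP BrwArFrm F_obj F_map
  (fun A => filter_brwArFrm (svalP A))
  (fun A B f => exist _ (filter_image (svalP A) (svalP B) (svalP f))
                  (filter_image_mor (svalP A) (svalP B) (svalP f))) _ _ _).
- by [].
- move=> A; apply: chom_eq; apply/funext => F; apply/val_inj/seteqP.
  split=> a; rewrite in_filter_image /=; last by exists a.
  by move=> [b Fb ba]; have [_ Fup _] := asboolW (valP F); exact: Fup ba.
- move=> A B E g f; apply: chom_eq; apply/funext => F; apply/val_inj/seteqP.
  have [gmeets _ _ _] := svalP g.
  split=> a /in_filter_image.
    move=> [b Fb ba]; apply/in_filter_image; exists (sval f b) => //.
    by apply/in_filter_image; exists b.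
  move=> [b /in_filter_image[c Fc cb] ba]; apply/in_filter_image;
    exists c => //.
  exact: le_trans (preserves_meets_le gmeets cb) ba.
Defined.

(** * Compact elements and the functor K *)

Section compact_lattice.
Variable L : poset.
Hypothesis objL : @is_obj BrwArFrm L.
Implicit Types (k l m : compacts_dual L) (S : set (compacts_dual L)).

Let algL : @algebraic_frame _ L. Proof. by case: objL => -[]. Qed.
Let supL (S : set L) : supremums S !=set0. Proof. by case: algL => -[]. Qed.
Let infL (S : set L) : infimums S !=set0. Proof. exact: frame_infimums. Qed.

Lemma compact_valP k : compact_elt (compact_val k).
Proof. exact: asboolW (valP (k : compacts L)). Qed.

Definition to_compact (x : L) (xc : compact_elt x) : compacts_dual L :=
  Sub x (asboolT xc) : compacts L.

Lemma to_compactK x (xc : compact_elt x) : compact_val (to_compact xc) = x.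
Proof. by []. Qed.

Lemma le_compact_val k l : k <= l = (compact_val l <= compact_val k).
Proof. by []. Qed.

(** A finite join of compact elements is compact, so it is available as a meet in the reversed
    order. *)
Lemma compact_infimums S m : finite_set S ->
  infimums S m <-> supremums (@compact_val L @` S) (compact_val m).
Proof.
move=> Sf; split=> [Sm|/supremumsP mP]; last first.
  apply/infimumsP => x; rewrite le_compact_val mP;
    split=> [xS s Ss|xS _ [s Ss <-]].
    by rewrite le_compact_val; apply: xS; exists s.
  by rewrite -le_compact_val; exact: xS.
have [x Sx] := supL (@compact_val L @` S).
have xc : compact_elt x.
  apply: compact_supremums Sx => //; first exact: finite_image.
  by move=> _ [k _ <-]; exact: compact_valP.
suff -> : m = to_compact xc by rewrite to_compactK.
apply: infimums_unique Sm _; move/supremumsP: Sx => xP.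
apply/infimumsP => y; rewrite le_compact_val xP.
split=> [yS s Ss|yS _ [s Ss <-]]; last by rewrite -le_compact_val; exact: yS.
by rewrite le_compact_val; apply: yS; exists s.
Qed.

(** Here [S] may be infinite: a lower bound in [L] is the join of the compacts below it, so lower
    bounds among compacts determine the infimum. *)
Lemma compact_supremumsP S m :
  supremums S m <-> infimums (@compact_val L @` S) (compact_val m).
Proof.
split=> [/supremumsP mP|/infimumsP mP]; last first.
  apply/supremumsP => x; rewrite le_compact_val mP;
    split=> [xS s Ss|xS _ [s Ss <-]].
    by rewrite le_compact_val; apply: xS; exists s.
  by rewrite -le_compact_val; exact: xS.
apply/infimumsP => x; split=> [xm _ [s Ss <-]|xS].
  by apply: le_trans xm _; rewrite -le_compact_val; apply: (mP m).1.
apply: (algebraic_le algL) => k kc kx.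
rewrite -(to_compactK kc) -le_compact_val mP => s Ss.
by rewrite le_compact_val (le_trans kx)//; apply: xS; exists s.
Qed.

(** Arithmeticity makes the Brouwerian semilattice a lattice: meets of compacts in [L] are joins in
    the reversed order. *)
Lemma compact_brouwerian_algebra : @brouwerian_algebra _ (compacts_dual L).
Proof.
have [[_ meetL] [_ brwL]] := objL; split=> // k l.
have [x klx] := infL [set compact_val k; compact_val l].
have xc : compact_elt x by apply: meetL klx; exact: compact_valP.
exists (to_compact xc); apply/compact_supremumsP.
by rewrite image_setU !image_set1.
Qed.

(** In the order of [L] a filter of [compacts_dual L] is an ideal of compacts, hence directed; a
    compact below its join lies below a member. *)
Lemma compact_ideal_join (F : set (compacts_dual L)) (x : L) k : is_filter F ->
  supremums (@compact_val L @` F) x -> compact_val k <= x -> F k.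
Proof.
move=> /(is_filterP compact_brouwerian_algebra)[[l Fl] Fup Fm] Fx kx.
have [||_ [m Fm' <-] km] := compact_directed (compact_valP (k := k)) Fx kx.
- by exists (compact_val l), l.
- move=> _ _ [m Fm1 <-] [n Fn <-]; exists (compact_val (bmeet m n)).
  have Bc := compact_brouwerian_algebra.
  by rewrite -!le_compact_val bmeetl ?bmeetr//; split=> //;
    exists (bmeet m n) => //; exact: Fm.
by apply: Fup Fm' _; rewrite le_compact_val.
Qed.

Lemma below_filterP (x : L) : is_filter [set k | compact_val k <= x].
Proof.
apply/(is_filterP compact_brouwerian_algebra); split.
- have [m] := (brw_top compact_brouwerian_algebra).
  move=> /infimums0P/(compact_infimums _ (finite_set0 _)).
  rewrite image_set0 => /supremumsP m0; exists m => /=.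
  by apply/m0.
- by move=> k l /= kx; rewrite le_compact_val => /le_trans; apply.
- move=> k l kx lx /=.
  have /(compact_infimums _ (finite_set2 _ _)) := bmeet_inf
    compact_brouwerian_algebra k l.
  by rewrite image_setU !image_set1 => /supremums2P ->; rewrite kx.
Qed.

Definition below (x : L) : filters (compacts_dual L) :=
  Sub [set k | compact_val k <= x] (asboolT (below_filterP x)).

Lemma in_below x k : val (below x) k = (compact_val k <= x) :> Prop.
Proof. by []. Qed.

Lemma below_supremums x : supremums (@compact_val L @` val (below x)) x.
Proof.
split=> [_ [k kx <-]//|y yx]; apply: (algebraic_le algL) => k kc kx.
by apply: yx; exists (to_compact kc).
Qed.

Definition ideal_join (F : filters (compacts_dual L)) : L :=
  sval (boolp.cid (supL (@compact_val L @` val F))).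

Lemma ideal_join_sup F : supremums (@compact_val L @` val F) (ideal_join F).
Proof. by rewrite /ideal_join; case: boolp.cid. Qed.

Lemma belowK : cancel below ideal_join.
Proof. by move=> x; apply: supremums_unique (ideal_join_sup _) (below_supremums
  x). Qed.

Lemma ideal_joinK : cancel ideal_join below.
Proof.
move=> F; apply/val_inj/seteqP; split=> k; rewrite in_below; last first.
  by move=> Fk; have [Fub _] := ideal_join_sup F; apply: Fub; exists k.
exact: compact_ideal_join (asboolW (valP F)) (ideal_join_sup F).
Qed.

Lemma below_mono : {mono below : x y / x <= y}.
Proof.
move=> x y; apply/idP/idP => [/leFP xy|xy]; last first.
  by apply/leFP => k; rewrite !in_below => /le_trans; apply.
apply: (algebraic_le algL) => k kc kx.
by have := xy (to_compact kc); rewrite !in_below; apply.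
Qed.

End compact_lattice.

Section compact_morphism.
Variables (L M : poset) (f : L -> M).
Hypotheses (objL : @is_obj BrwArFrm L) (objM : @is_obj BrwArFrm M).
Hypothesis fmor : brwArFrm_mor f.

Definition compact_map : compacts_dual L -> compacts_dual M :=
  compacts_map (let: And4 _ _ fc _ := fmor in fc).

Lemma compact_mapE k : compact_val (compact_map k) = f (compact_val k).
Proof. by []. Qed.

Lemma compact_map_mor : brwAP_mor compact_map.
Proof.
have [fjoins fmeets _ fimp] := fmor.
have kmE S : @compact_val M @` (compact_map @` S) = f @` (@compact_val L @` S).
  by rewrite !image_comp.
have kmeets : preserves_finite_meets compact_map.
  move=> S m Sf /(compact_infimums objL _ Sf)/fjoins.
  by rewrite -kmE => Sm; apply/(compact_infimums objM) => //;
    exact: finite_image.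
have kjoins : preserves_finite_joins compact_map.
  move=> S m Sf /(compact_supremumsP objL)/fmeets.
  rewrite -kmE => Sm; apply/(compact_supremumsP objM)/Sm.
  exact: finite_image.
split=> //; first by move=> a b c; exact: fimp.
move=> P Pprime.
have [brwL brwM] := (compact_brouwerian_algebra objL,
  compact_brouwerian_algebra objM).
apply: prime_filter_preimage => //.
have /(prime_filterP brwM)[fP PT _] := Pprime; apply/existsNP => PA.
apply: PT; apply/seteqP; split=> // k _.
(* Suppose every [f k] is in [P]. The top [t] of [L] is a join of compacts and [f] preserves both
   joins and the top, so the join [q] of [P] is the top of [M]. Then every compact of [M] is in [P],
   against properness. *)
have [[[[supL _] _] _] _] := objL; have [[[[supM _] _] _] _] := objM.
have [t Tt] := supL setT; have [q Pq] := supM (@compact_val M @` P).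
apply: (compact_ideal_join objM fP Pq).
have ttop : is_top t by move=> x; case: Tt => + _; apply.
apply: le_trans (preserves_top fmeets ttop _) _.
have := below_supremums objL t; move=> /fjoins/supremumsP -> _ [_ [l _ <-] <-].
have [Pub _] := Pq; apply: Pub; rewrite -compact_mapE.
by exists (compact_map l).
Qed.

End compact_morphism.

Definition K_restriction : restriction BrwArFrm BrwAP K_obj K_map.
Proof.
refine (@Restriction BrwArFrm BrwAP K_obj K_map
  (fun L => compact_brouwerian_algebra (svalP L))
  (fun L M f => exist _ (compact_map (svalP f))
                  (compact_map_mor (svalP L) (svalP M) (svalP f))) _ _ _).
- by [].
- by move=> L; apply: chom_eq; apply/funext => k; exact: val_inj.
- by move=> L M N g f; apply: chom_eq; apply/funext => k; exact: val_inj.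
Defined.

Lemma FK_equivalence : equivalence F_restriction K_restriction.
Proof.
split.
  apply: naturally_isomorphic_sym.
  apply: (@concrete_natural_iso BrwAP BrwAP (id_functor BrwAP)
    (comp_functor K_restriction F_restriction)
    (fun A => compact_principal_elt (svalP A)) (fun A => generator (svalP A))).
  - move=> A; apply: iso_brwAP_mor (compact_principalK _) (generatorK _)
    (compact_principal_mono _).
      exact: svalP A.
    exact: compact_brouwerian_algebra (filter_brwArFrm (svalP A)).
  - move=> A; apply: iso_brwAP_mor (generatorK _) (compact_principalK _) _.
    + exact: compact_brouwerian_algebra (filter_brwArFrm (svalP A)).
    + exact: svalP A.
    + exact: can_mono_le (generatorK _) (compact_principal_mono _).
  - by move=> A; exact: compact_principalK.
  - by move=> A; exact: generatorK.
  - move=> A B f a; apply: val_inj => /=.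
    by rewrite filter_image_principal.
apply: naturally_isomorphic_sym.
apply: (@concrete_natural_iso BrwArFrm BrwArFrm (id_functor BrwArFrm)
  (comp_functor F_restriction K_restriction)
  (fun L => below (svalP L)) (fun L => @ideal_join _ (svalP L))).
- move=> L.
  by apply: (@iso_brwArFrm_mor _ (Poset (filters (compacts_dual (sval L)))) _ _
    (belowK _) (ideal_joinK _) (below_mono _)).
- move=> L.
  by apply: (@iso_brwArFrm_mor (Poset (filters (compacts_dual (sval L)))) _ _ _
    (ideal_joinK _) (belowK _) (can_mono_le (ideal_joinK _) (below_mono _))).
- by move=> L; exact: belowK.
- by move=> L; exact: ideal_joinK.
move=> L M f x; apply: val_inj; apply/seteqP; split=> k; rewrite in_below.
  move=> kfx; apply/in_filter_image.
  have [fjoins fmeets _ _] := svalP f.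
  (* The images under [f] of the compacts below [x] form a directed family with join [f x], so the
     compact [k] is below one of them. *)
  have [||_ [_ [l lx <-] <-] kl] :=
    compact_directed (compact_valP (k := k)) (fjoins _ _ (below_supremums
      (svalP L) x)) kfx.
  - have [[l lx] _ _] := below_filterP (svalP L) x.
    by exists (sval f (compact_val l)), (compact_val l) => //; exists l.
  - move=> _ _ [_ [l lx <-] <-] [_ [m mx <-] <-].
    have brwL := compact_brouwerian_algebra (svalP L).
    exists (sval f (compact_val (bmeet l m))); split.
    + exists (compact_val (bmeet l m)) => //; exists (bmeet l m) => //.
      by have [_] := filter_bmeet brwL l m (below_filterP (svalP L) x); apply.
    + by apply: (preserves_meets_le fmeets); rewrite -le_compact_val bmeetl.
    + by apply: (preserves_meets_le fmeets); rewrite -le_compact_val bmeetr.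
  by exists l.
move=> /in_filter_image[l lx]; rewrite le_compact_val => /le_trans; apply.
by have [_ fmeets _ _] := svalP f; exact: (preserves_meets_le fmeets lx).
Qed.

(** * The space of optimal filters *)

(** If no member of [D] covered [C], the differences of [C] and these members would form a proper
    filter base; a cluster point in [C] would lie in a member of [D] that is disjoint from one of
    them. *)
Lemma compact_directed_cover (X : topologicalType) (C : set X) (D :
  set (set X)) :
  compact C -> D !=set0 -> (forall U, D U -> open U) ->
  (forall U V, D U -> D V -> exists W, [/\ D W, U `<=` W & V `<=` W]) ->
  C `<=` \bigcup_(U in D) U -> exists2 U, D U & C `<=` U.
Proof.
move=> Cc [U0 DU0] Dopen dirD CD; apply: contrapT => noU.
pose G := filter_from D (fun U => C `\` U).
have Gproper : ProperFilter G.
  apply: filter_from_proper.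
    apply: filter_from_filter; first by exists U0.
    move=> U V DU DV; have [W [DW UW VW]] := dirD _ _ DU DV; exists W => //.
    by move=> x [Cx Wx]; split; [split=> // /UW|split=> // /VW].
  move=> U DU; apply: contrapT => CU; apply: noU; exists U => // x Cx.
  by apply: contrapT => Ux; apply: CU; exists x.
have [|x [Cx xG]] := Cc G Gproper; first by exists U0 => // x [].
have [U DU Ux] := CD x Cx.
have GU : G (C `\` U) by exists U.
have [|y [[_ nUy] Uy]] := xG _ U GU.
  by apply: open_nbhs_nbhs; split=> //; exact: Dopen.
exact: nUy.
Qed.

Lemma can_continuous (X Y : topologicalType) (f : X -> Y) (g : Y -> X) :
  compact [set: X] -> hausdorff_space Y -> continuous f ->
  cancel f g -> cancel g f -> continuous g.
Proof.
move=> Xc Yh fc fK gK; apply/continuous_closedP => C Ccl.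
have -> : g @^-1` C = f @` C.
  by apply/seteqP; split=> [y Cy|_ [x Cx <-]]; [exists (g y)|rewrite /= fK].
apply: compact_closed => //; apply: continuous_compact.
  exact: continuous_subspaceT.
exact: subclosed_compact Ccl Xc _.
Qed.

(** Open sets are the unions of finite intersections from [D]. Stated as an equation, it holds by
    conversion for both spaces of points, which then share the lemmas below. *)
Definition generated_by (T : topologicalType) (D : set (set T)) :=
  @open T = [set \bigcup_(V in C) V | C in [set C | C `<=` finI_from D id]].

Section subbase.
Variables (T : topologicalType) (D : set (set T)).
Hypothesis openD : generated_by D.

Lemma subbase_open U : D U -> open U.
Proof.
move=> DU; rewrite openD; exists [set U]; last by rewrite bigcup_set1.
by move=> _ ->; exact: (@finI_from1 _ _ D id).
Qed.

(** The family [B] is arbitrary, so this works as an induction principle: besides a base of the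
    topology, [B] can be the sets with open preimage, or those that belong to a filter whenever they
    contain a given point. *)
Lemma subbase_base (B : set (set T)) : B setT -> D `<=` B ->
  (forall U V, B U -> B V -> B (U `&` V)) ->
  forall U x, open U -> U x -> exists W, [/\ B W, W x & W `<=` U].
Proof.
move=> BT DB BI U x; rewrite openD => -[C CD <-] [V CV Vx].
exists V; split=> //; last by move=> y Vy; exists V.
have [S SD <-] := CD _ CV; have SB : [set` S] `<=` B.
  by move=> W /= /SD; rewrite inE; exact: DB.
have := finite_fset S; move: [set` S] SB => E EB Ef.
elim/finite_set_ind: E / Ef EB => [_|W E _ IHE WEB];
  first by rewrite bigcap_set0.
rewrite bigcap_setU1; apply: BI; first by apply: WEB; left.
by apply: IHE => W' EW'; apply: WEB; right.
Qed.

Lemma subbase_continuous (X : topologicalType) (f : X -> T) :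
  (forall U, D U -> open (f @^-1` U)) -> continuous f.
Proof.
move=> fD; apply/continuousP => U Uo; rewrite openE => x Ux.
have [|||W [Wo Wx WU]] := subbase_base (B := [set V | open (f @^-1` V)]) _ _ _
  Uo Ux.
- exact: openT.
- exact: fD.
- by move=> V W Vo Wo; exact: openI.
by apply: filterS (open_nbhs_nbhs (conj Wo Wx)) => y /WU.
Qed.

End subbase.

Lemma optimals_generated (A : poset) : generated_by (@optimals_subbasis A).
Proof. by []. Qed.

Lemma pseudoprimes_generated (A : poset) :
  generated_by (@pseudoprimes_subbasis A).
Proof. by []. Qed.

Lemma iso_pesP_mor (X Y : triple) (f : X -> Y) (g : Y -> X) :
  cancel f g -> cancel g f -> {mono f : x y / x <= y} -> continuous f ->
  f (tpt X) = tpt Y -> pesP_mor f.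
Proof.
move=> fK gK fle fc ftop; split=> // [y|].
  apply/seteqP; split=> x.
    by move=> [z <- xz]; exists (f z); rewrite ?fle.
  by move=> [_ -> xy]; exists (g y); rewrite /= ?gK// -fle gK.
by apply/seteqP; split=> x /=; [rewrite -ftop => /(can_inj fK)|move=> ->].
Qed.

Lemma iso_pointed_esakia (X Y : triple) (f : X -> Y) (g : Y -> X) :
  cancel f g -> cancel g f -> {mono f : x y / x <= y} ->
  continuous f -> continuous g -> f (tpt X) = tpt Y -> f @` tset X = tset Y ->
  pointed_esakia_space X -> pointed_esakia_space Y.
Proof.
move=> fK gK fle fc gc ftop fset [[Xc Xsep Xdown] Xtop XE].
have gle := can_mono_le gK fle.
split; first split.
- have -> : [set: Y] = f @` setT.
    by apply/seteqP; split=> // y _; exists (g y).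
  by apply: continuous_compact Xc; exact: continuous_subspaceT.
- move=> x y xy; have [|U [Uc Uup Ux Uy]] := Xsep (g x) (g y).
    by rewrite gle.
  exists (g @^-1` U); split=> //; first exact: preimage_clopen.
  by move=> u v Ugu uv; apply: Uup Ugu _; rewrite gle.
- move=> U Uc; have -> : down_closure U = g @^-1` down_closure (f @^-1` U).
    apply/seteqP; split=> x [y Uy xy].
      by exists (g y); rewrite /= ?gK ?gle.
    by exists (f y) => //; rewrite (le_can gK fle) in xy *.
  by apply: preimage_clopen => //; apply: Xdown; exact: preimage_clopen.
- by rewrite -ftop => y; rewrite (le_can gK fle).
- have XP x : tset X x <-> x <> tpt X by rewrite XE.
  rewrite -fset -ftop; apply/seteqP; split=> [_ [x /XP xtop <-]|y ytop].
    by move=> /(can_inj fK).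
  by exists (g y); rewrite ?gK//; apply/XP => gy; apply: ytop;
    rewrite /= -gy gK.
Qed.

Section optimal_filters.
Variable A : poset.
Hypothesis brwA : @brouwerian_algebra _ A.
Implicit Types (a b : A) (x y : optimals A).

Lemma optimal_filter x : is_filter (val x).
Proof. by have /(optimalsP brwA)[] := asboolW (valP x). Qed.

Lemma optimal_join_prime x : join_prime (val x).
Proof. by have /(optimalsP brwA)[] := asboolW (valP x). Qed.

Definition to_optimal (F : set A) (FP : is_filter F /\ join_prime F) :
  optimals A :=
  Sub F (asboolT ((optimalsP brwA F).2 FP)).

Lemma leOP x y : x <= y <-> val x `<=` val y.
Proof. by rewrite leEsub -subsetEset. Qed.

Lemma prime_optimal x : prime_filter (val x) <-> x <> optimals_top A.
Proof.
rewrite (prime_filterP brwA); split=> [[_ xT _] ex|xtop].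
  by apply: xT; rewrite ex.
split; [exact: optimal_filter| |exact: optimal_join_prime].
by move=> xT; apply: xtop; exact: val_inj.
Qed.

Lemma phi_meet a b : phi (bmeet a b) = phi a `&` phi b.
Proof.
by apply/seteqP; split=> x;
  have := filter_bmeet brwA a b (optimal_filter x) => -[];
  move=> h1 h2; [exact: h1|exact: h2].
Qed.

Lemma phi_join a b : phi (bjoin a b) = phi a `|` phi b.
Proof.
apply/seteqP; split=> x; first exact: optimal_join_prime.
have [_ xup _] := optimal_filter x.
by move=> [xa|xb]; [apply: xup xa _; exact: bjoinl|apply: xup xb _;
  exact: bjoinr].
Qed.

Lemma phi_top a : is_top a -> phi a = setT.
Proof.
move=> aT; apply/seteqP; split=> // x _.
by apply: filter_top aT; exact: optimal_filter.
Qed.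

Lemma phi_clopen a : clopen (phi a).
Proof.
split; last (rewrite -[phi a]setCK; apply: open_closedC).
  by apply: (subbase_open (@optimals_generated A)); left; exists a.
by apply: (subbase_open (@optimals_generated A)); right; exists a.
Qed.

Lemma phi_upset a : is_upset (phi a).
Proof. by move=> x y xa /leOP; apply. Qed.

(** Two shapes occur because every [phi b] contains the improper filter: a difference never is a
    neighbourhood of the top point, while [phi a] always is. *)
Lemma optimals_base (U : set (optimals A)) x : open U -> U x ->
  exists W, [/\ (exists a, W = phi a) \/ exists a b, W = phi a `\` phi b,
                W x & W `<=` U].
Proof.
have [t tT] := brw_top brwA.
apply: (subbase_base (@optimals_generated A)).
- by left; exists t; rewrite phi_top.
- move=> _ [[a _ <-]|[b _ <-]]; first by left; exists a.
  by right; exists t, b; rewrite (phi_top tT) setTD.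
- move=> _ _ [[a ->]|[a [b ->]]] [[c ->]|[c [d ->]]].
  + by left; exists (bmeet a c); rewrite phi_meet.
  + right; exists (bmeet a c), d.
    by rewrite phi_meet; apply/seteqP; split=> y /=; tauto.
  + right; exists (bmeet a c), b.
    by rewrite phi_meet; apply/seteqP; split=> y /=; tauto.
  + right; exists (bmeet a c), (bjoin b d).
    by rewrite phi_meet phi_join; apply/seteqP; split=> y /=; tauto.
Qed.

(** An ultrafilter [F] converges to the set of all [a] with [phi a] in [F]. This is a join-prime
    filter, possibly improper, which explains why the top point belongs to the space. *)
Lemma optimals_compact : compact [set: optimals A].
Proof.
rewrite compact_ultra => F Fultra _.
pose P := [set a | F (phi a)].
have fP : is_filter P.
  apply/(is_filterP brwA); split.
  - by have [t tT] := brw_top brwA; exists t; rewrite /P /= phi_top//;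
    exact: filterT.
  - move=> a b Fa ab; apply: filterS Fa => x xa.
    by have [_ xup _] := optimal_filter x; exact: xup ab.
  - by move=> a b Fa Fb; rewrite /P /= phi_meet; exact: (filterI Fa Fb).
have pP : join_prime P.
  move=> a b; rewrite /P /= phi_join => Fab.
  have [|Fa] := in_ultra_setVsetC (phi a) Fultra; first by left.
  right; suff : F (phi b) by [].
  by apply: filterS (filterI Fab Fa) => x [[xa|xb] nxa].
exists (to_optimal (conj fP pP)); split=> // U;
  rewrite nbhsE => -[V [Vo Vx] VU].
have [|||W [WF Wx WV]] := subbase_base (@optimals_generated A)
  (B := [set W | W (to_optimal (conj fP pP)) -> F W]) _ _ _ Vo Vx.
- by move=> _; exact: filterT.
- move=> _ [[a _ <-]//|[b _ <-] nFb].
  by have [Fb|//] := in_ultra_setVsetC (phi b) Fultra; case: (nFb Fb).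
- by move=> W W' WF W'F [Wx W'x]; apply: filterI; [exact: WF|exact: W'F].
by apply: filterS (WF Wx) => y /WV /VU.
Qed.

Lemma optimals_hausdorff : hausdorff_space (optimals A).
Proof.
rewrite open_hausdorff => x y xy.
suff [a [[xa ya]|[ya xa]]] :
  exists a, (val x a /\ ~ val y a) \/ (val y a /\ ~ val x a).
- exists (phi a, ~` phi a) => /=; first by rewrite !inE.
  split; [by have [] := phi_clopen a| |by rewrite setICr].
  by have [_ ?] := phi_clopen a; exact: closed_openC.
- exists (~` phi a, phi a) => /=; first by rewrite !inE.
  split; [|by have [] := phi_clopen a|by rewrite setICl].
  by have [_ ?] := phi_clopen a; exact: closed_openC.
apply: contrapT => noa; move/eqP: xy; apply; apply/val_inj/seteqP.
by split=> a ax; apply: contrapT => nax; apply: noa; exists a; [left|right].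
Qed.

(** If [bimp a b] is not in [x], the filter generated by [x] and [a] omits [b], and prime separation
    extends it to a point above [x] that contains [a] and omits [b]. The converse is modus
    ponens. *)
Lemma down_closure_diff a b :
  down_closure (phi a `\` phi b) = ~` phi (bimp a b).
Proof.
apply/seteqP; split=> x.
  move=> [y [ya yb] /leOP xy] /xy yab; apply: yb.
  have [_ yup _] := optimal_filter y.
  apply: (yup (bmeet a (bimp a b))); last by rewrite -le_bimp.
  exact/(filter_bmeet brwA _ _ (optimal_filter y)).
move=> xab; have fx := optimal_filter x; have [_ xup _] := fx.
(* By residuation, this is the filter generated by [x] and [a]. *)
pose F := [set c | val x (bimp a c)].
have fF : is_filter F.
  apply/(is_filterP brwA); split.
  - have [t tT] := brw_top brwA; exists t; apply: (filter_top fx) => c.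
    by rewrite le_bimp.
  - move=> c d Fc cd; apply: xup Fc _; rewrite le_bimp//.
    by apply: le_trans cd; rewrite -le_bimp.
  - move=> c d Fc Fd; apply: (xup (bmeet (bimp a c) (bimp a d))).
      exact/(filter_bmeet brwA _ _ fx).
    rewrite le_bimp// le_bmeet//; apply/andP.
    by split; rewrite -le_bimp//; [exact: bmeetl|exact: bmeetr].
have [P [fP pP FP Pb]] := prime_separation1 brwA fF xab.
exists (to_optimal (conj fP pP)); first split=> //.
  by apply: FP; apply: (filter_top fx) => c; rewrite le_bimp// bmeetl.
apply/leOP => c xc; apply: FP; apply: xup xc _.
by rewrite le_bimp// bmeetr.
Qed.

Lemma optimals_pointed_esakia : pointed_esakia_space
  (@Triple _ (optimals A) [set x | prime_filter (val x)] (optimals_top A)).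
Proof.
have toptop : is_top (optimals_top A) by move=> x; apply/leOP.
split=> //; last first.
  by apply/seteqP; split=> x /= /prime_optimal.
split; first exact: optimals_compact.
  move=> x y /negP xy; have [a [xa ya]] : exists a, val x a /\ ~ val y a.
    apply: contrapT => noa; move/negP: xy; apply; apply/leOP => a xa.
    by apply: contrapT => ya; apply: noa; exists a.
  by exists (phi a); split=> //; [exact: phi_clopen|exact: phi_upset].
move=> U [Uo Ucl].
have Uc : compact U by exact: subclosed_compact Ucl optimals_compact _.
(* These sets form a directed cover of the compact set [U], so [U] is one of them. Basic sets
   qualify: the down-closure of [phi a] is everything, as the top point lies in [phi a], and
   differences fall under [down_closure_diff]. *)
pose D := [set W | [/\ open W, W `<=` U & clopen (down_closure W)]].
have downU (V W : set (optimals A)) :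
    down_closure (V `|` W) = down_closure V `|` down_closure W.
  apply/seteqP; split=> x.
    by move=> [y [Vy|Wy] xy]; [left|right]; exists y.
  by move=> [] [y Vy xy]; exists y => //; [left|right].
have [||||W [_ WU Wd] UW] := compact_directed_cover Uc (D := D).
- exists set0; split=> //; first exact: open0.
  suff -> : down_closure set0 = set0 :> set (optimals A) by exact: clopen0.
  by apply/seteqP; split=> // x [].
- by move=> V [].
- move=> V W [Vo VU Vd] [Wo WU Wd]; exists (V `|` W); split=> //; split.
  + exact: openU.
  + by move=> x [/VU|/WU].
  + by rewrite downU; exact: clopenU.
- move=> x Ux; have [W [WB Wx WU]] := optimals_base Uo Ux.
  exists W => //; move: WB WU => [[a ->]|[a [b ->]]] WU; split=> //.
  + by have [] := phi_clopen a.
  + suff -> : down_closure (phi a) = setT by exact: clopenT.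
    by apply/seteqP; split=> // y _; exists (optimals_top A).
  + apply: openI; first by have [] := phi_clopen a.
    by have [_ ?] := phi_clopen b; exact: closed_openC.
  + by rewrite down_closure_diff; apply: (clopenC set0); exact: phi_clopen.
have -> : U = W by apply/seteqP; split.
by [].
Qed.

End optimal_filters.

(** * The functor X and admissible clopen upsets *)

Section optimal_morphism.
Variables (A B : poset) (h : A -> B).
Hypotheses (brwA : @brouwerian_algebra _ A) (brwB : @brouwerian_algebra _ B).
Hypothesis hmor : brwAP_mor h.

Let hmeets : preserves_finite_meets h. Proof. by case: hmor. Qed.
Let hjoins : preserves_finite_joins h. Proof. by case: hmor. Qed.

Definition optimal_preimage (x : optimals B) : optimals A :=
  to_optimal brwA (conj (filter_preimage brwA hmeets (optimal_filter brwB x))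
                        (join_prime_preimage brwA brwB hjoins
                           (optimal_join_prime brwB (x := x)))).

Lemma optimal_preimageE x : val (optimal_preimage x) = h @^-1` val x.
Proof. by []. Qed.

Lemma optimal_preimage_continuous : continuous optimal_preimage.
Proof.
apply: (subbase_continuous (@optimals_generated A)) => _ [[a _ <-]|[a _ <-]].
  by have [] := phi_clopen (h a).
by have [_ ?] := phi_clopen (h a); exact: closed_openC.
Qed.

Lemma optimal_preimage_mono x y :
  x <= y -> optimal_preimage x <= optimal_preimage y.
Proof. by move=> /leOP xy; apply/leOP => a; exact: xy. Qed.

(** The point [z] separates the filter generated by [x] and the image of [y] from the image of the
    complement of [y]. Were the two to meet, some [p] in [x], [a] in [y] and [c] outside [y] would
    have the meet of [p] and [h a] below [h c]. As [h] preserves implication, [h (bimp a c)] would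
    be in [x], so [bimp a c] and then [c] would be in [y]. *)
Lemma optimal_preimage_lift (x : optimals B) (y : optimals A) :
  optimal_preimage x <= y -> exists2 z, x <= z & optimal_preimage z = y.
Proof.
move=> /leOP xy; have fx := optimal_filter brwB x;
  have fy := optimal_filter brwA y.
pose F := [set b | exists p a, [/\ val x p, val y a & bmeet p (h a) <= b]].
pose I := [set b | exists2 a, ~ val y a & b = h a].
have [||b [p [a [xp ya pab]]] [c yc ec]|P [fP pP FP PI]] :=
    @prime_separation B brwB F I.
- apply/(is_filterP brwB); split.
  + have [[p xp] _ _] := fx; have [[a ya] _ _] := fy.
    by exists (bmeet p (h a)), p, a.
  + move=> b c [p [a [xp ya pab]]] bc; exists p, a; split=> //.
    exact: le_trans bc.
  + move=> b c [p [a [xp ya pab]]] [q [d [xq yd qdc]]].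
    exists (bmeet p q), (bmeet a d); split;
      [exact/filter_bmeet|exact/filter_bmeet|].
    have hmono := preserves_meets_le hmeets.
    rewrite le_bmeet//; apply/andP; split;
      [apply: le_trans pab|apply: le_trans qdc];
      rewrite le_bmeet//; apply/andP; split.
    * by apply: le_trans (bmeetl _ _ _) (bmeetl _ _ _).
    * by apply: le_trans (bmeetr _ _ _) (hmono _ _ (bmeetl _ _ _)).
    * by apply: le_trans (bmeetl _ _ _) (bmeetr _ _ _).
    * by apply: le_trans (bmeetr _ _ _) (hmono _ _ (bmeetr _ _ _)).
- move=> _ _ [a ya ->] [b yb ->]; exists (h (bjoin a b)); split.
  + by exists (bjoin a b) => // /(optimal_join_prime brwA)[].
  + by apply: (preserves_meets_le hmeets); exact: bjoinl.
  + by apply: (preserves_meets_le hmeets); exact: bjoinr.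
- subst b; apply: yc; have [_ yup _] := fy.
  apply: (yup (bmeet a (bimp a c))); last by rewrite -le_bimp.
  apply/(filter_bmeet brwA _ _ fy); split=> //; apply: xy.
  rewrite optimal_preimageE /=; have [_ xup _] := fx; apply: xup xp _.
  have [_ himp _ _] := hmor.
  have /(is_imp_bimp brwB) -> := himp _ _ _ (bimp_imp brwA a c).
  rewrite le_bimp//; apply: le_trans pab.
  by rewrite le_bmeet// bmeetr ?bmeetl.
have [[p xp] _ _] := fx; have [[a0 ya0] _ _] := fy.
exists (to_optimal brwB (conj fP pP)).
  by apply/leOP => b xb; apply: FP; exists b, a0; split=> //; exact: bmeetl.
apply/val_inj/seteqP; split=> a; rewrite optimal_preimageE /=.
  by move=> Pa; apply: contrapT => ya; apply: (PI _ Pa); exists a.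
by move=> ya; apply: FP; exists p, a; split=> //; exact: bmeetr.
Qed.

Lemma optimal_preimage_mor : @pesP_mor
  (@Triple _ (optimals B) [set x | prime_filter (val x)] (optimals_top B))
  (@Triple _ (optimals A) [set x | prime_filter (val x)] (optimals_top A))
  optimal_preimage.
Proof.
split=> [|y|]; first exact: optimal_preimage_continuous.
  apply/seteqP; split=> x.
    by move=> [z <- xz]; exists (optimal_preimage z) => //;
      exact: optimal_preimage_mono.
  by move=> [_ -> /optimal_preimage_lift[z xz zy]]; exists z.
apply/seteqP; split=> x /=; last by move=> ->; exact: val_inj.
(* A point other than the top is a prime filter; the last clause of [brwAP_mor] keeps its preimage
   prime, hence different from the top. *)
move=> xtop; apply: contrapT => /(prime_optimal brwB) xprime.
have [_ _ _ /(_ _ xprime)] := hmor.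
by rewrite -optimal_preimageE => /(prime_optimal brwA); apply.
Qed.

End optimal_morphism.

Definition X_corestriction : corestriction BrwAP PESP X_obj X_map.
Proof.
refine (@Corestriction BrwAP PESP X_obj X_map
  (fun A => optimals_pointed_esakia (svalP A))
  (fun A B h => exist _ (optimal_preimage (svalP A) (svalP B) (svalP h))
                  (optimal_preimage_mor (svalP A) (svalP B) (svalP h))) _ _ _).
- by [].
- by move=> A; apply: chom_eq; apply/funext => x; exact: val_inj.
- by move=> A B E g f; apply: chom_eq; apply/funext => x; exact: val_inj.
Defined.

(** * The algebra of admissible clopen upsets of a pointed Esakia space, and its points *)

Section pointed_esakia.
Variable X : triple.
Hypothesis esakiaX : pointed_esakia_space X.
Implicit Types (x y : X) (S : set X).

Let m := tpt X.

Let mtop : is_top m. Proof. by case: esakiaX. Qed.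
Let Xcompact : compact [set: X]. Proof. by case: esakiaX => -[]. Qed.

Lemma esakia_separation x y : ~ x <= y ->
  exists U : set X, [/\ clopen U, is_upset U, U x & ~ U y].
Proof. by have [[_ + _] _ _] := esakiaX; apply. Qed.

Lemma esakia_separation_pt x : x <> m ->
  exists U : set X, [/\ clopen U, is_upset U, U m & ~ U x].
Proof.
move=> xm; apply: esakia_separation => mx; apply: xm; apply/eqP.
by rewrite eq_le mx mtop.
Qed.

Lemma admissible_upset S : is_upset S -> admissible S <-> S m.
Proof.
have XP x : tset X x <-> x <> m by have [_ _ ->] := esakiaX.
move=> Sup; split=> [Sadm|Sm x Sx].
  apply: contrapT => Sm; have [y [/XP ym _] my] := Sadm m Sm.
  by apply: ym; apply/eqP; rewrite eq_le my mtop.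
by exists x => //; split=> //; apply/XP => xm; apply: Sx; rewrite xm.
Qed.

Local Notation AX := (admissible_clopen_upsets X).
Implicit Types (U V W : AX).

Lemma acu_clopen U : clopen (val U).
Proof. by have [] := asboolW (valP U). Qed.

Lemma acu_upset U : is_upset (val U).
Proof. by have [] := asboolW (valP U). Qed.

Lemma acu_pt U : val U m.
Proof. by have [adm _ up] := asboolW (valP U); apply/(admissible_upset up). Qed.

Definition to_acu S (Sc : clopen S) (Sup : is_upset S) (Sm : S m) : AX :=
  Sub S (asboolT (And3 ((admissible_upset Sup).2 Sm) Sc Sup)).

Lemma leAP U V : U <= V <-> val U `<=` val V.
Proof. by rewrite leEsub -subsetEset. Qed.

Lemma acu_setI U V : exists W, val W = val U `&` val V.
Proof.
unshelve eexists (@to_acu (val U `&` val V) _ _ _) => //.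
- by apply: clopenI; exact: acu_clopen.
- by move=> x y [Ux Vx] xy; split; [exact: acu_upset xy|exact: acu_upset xy].
- by split; exact: acu_pt.
Qed.

Lemma acu_setU U V : exists W, val W = val U `|` val V.
Proof.
unshelve eexists (@to_acu (val U `|` val V) _ _ _) => //.
- by apply: clopenU; exact: acu_clopen.
- by move=> x y [Ux|Vx] xy; [left; exact: acu_upset xy|right;
  exact: acu_upset xy].
- by left; exact: acu_pt.
Qed.

Lemma acu_setT : exists W, val W = setT.
Proof. by unshelve eexists (@to_acu setT _ _ _) => //; exact: clopenT. Qed.

Lemma acu_setD U V : exists W, val W = ~` down_closure (val U `\` val V).
Proof.
unshelve eexists (@to_acu (~` down_closure (val U `\` val V)) _ _ _) => //.
- have [[_ _ downX] _ _] := esakiaX; apply: (clopenC set0); apply: downX.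
  rewrite setDE; apply: clopenI; first exact: acu_clopen.
  by apply: (clopenC set0); exact: acu_clopen.
- by move=> x y xUV xy [z UVz yz]; apply: xUV; exists z => //;
  exact: le_trans yz.
- move=> [z [_ Vz] mz]; apply: Vz; exact: acu_upset (acu_pt V) mz.
Qed.

Lemma acu_infimums U V W : infimums [set U; V] W <-> val W = val U `&` val V.
Proof.
have [I eI] := acu_setI U V.
have UVI : infimums [set U; V] I.
  apply/infimums2P => E; apply/idP/andP => [/leAP EI|[/leAP EU /leAP EV]].
    by split; apply/leAP => x /EI; rewrite eI => -[].
  by apply/leAP => x Ex; rewrite eI; split; [exact: EU|exact: EV].
split=> [/(infimums_unique UVI) <-//|eW].
by have -> : W = I by apply: val_inj; rewrite eW eI.
Qed.

Lemma acu_supremums U V W : supremums [set U; V] W <-> val W = val U `|` val V.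
Proof.
have [J eJ] := acu_setU U V.
have UVJ : supremums [set U; V] J.
  apply/supremums2P => E; apply/idP/andP => [/leAP JE|[/leAP UE /leAP VE]].
    by split; apply/leAP => x Ux; apply: JE; rewrite eJ; [left|right].
  by apply/leAP => x; rewrite eJ => -[/UE|/VE].
split=> [/(supremums_unique UVJ) <-//|eW].
by have -> : W = J by apply: val_inj; rewrite eW eJ.
Qed.

Lemma acu_is_top U : is_top U <-> val U = setT.
Proof.
split=> [UT|eU V]; last by apply/leAP; rewrite eU.
have [W eW] := acu_setT; apply/seteqP; split=> // x _.
by have /leAP := UT W; rewrite eW; apply.
Qed.

Lemma acu_meet_semilattice : @meet_semilattice _ AX.
Proof.
apply: meet_semilatticeP.
  by have [W eW] := acu_setT; exists W; apply/acu_is_top.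
by move=> U V; have [W eW] := acu_setI U V; exists W; apply/acu_infimums.
Qed.

Lemma acu_is_imp U V W : is_imp U V W <-> val W = ~` down_closure (val U `\`
  val V).
Proof.
have impP E : val E = ~` down_closure (val U `\` val V) -> is_imp U V E.
  move=> eE; apply/(is_impP _ _ _ acu_meet_semilattice) => C D.
  move=> /acu_infimums eD; apply/idP/idP => [/leAP CE|/leAP DV].
    apply/leAP => x; rewrite eD => -[Ux /CE]; rewrite eE => xUV.
    by apply: contrapT => Vx; apply: xUV; exists x.
  apply/leAP => x Cx; rewrite eE => -[y [Uy Vy] xy]; apply/Vy/DV.
  by rewrite eD; split=> //; exact: acu_upset xy.
have [E eE] := acu_setD U V; split=> [UVW|]; last exact: impP.
suff -> : W = E by [].
apply/eqP; rewrite eq_le.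
by apply/andP; split; [apply/(impP _ eE)/UVW|apply/UVW/(impP _ eE)].
Qed.

Lemma acu_brouwerian_algebra : @brouwerian_algebra _ (Poset AX).
Proof.
split; first split; first exact: acu_meet_semilattice.
  by move=> U V; have [W eW] := acu_setD U V; exists W; apply/acu_is_imp.
by move=> U V; have [W eW] := acu_setU U V; exists W; apply/acu_supremums.
Qed.

Lemma acu_bmeet U V : val (bmeet (U : Poset AX) V : AX) = val U `&` val V.
Proof. exact/acu_infimums/(bmeet_inf acu_brouwerian_algebra). Qed.

Lemma acu_bjoin U V : val (bjoin (U : Poset AX) V : AX) = val U `|` val V.
Proof. exact/acu_supremums/(bjoin_sup acu_brouwerian_algebra). Qed.

Lemma acu_point_filter x : is_filter [set U : Poset AX | val U x].
Proof.
split.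
- by have [W eW] := acu_setT; exists W; rewrite /= eW.
- by move=> U V /= Ux /leAP; apply.
- by move=> U V W Ux Vx /acu_infimums eW; rewrite /= eW.
Qed.

Lemma acu_point_prime x : join_prime [set U : Poset AX | val U x].
Proof. by move=> U V /=; rewrite acu_bjoin. Qed.

Definition point_filter x : optimals (Poset AX) :=
  to_optimal acu_brouwerian_algebra
    (conj (acu_point_filter x) (@acu_point_prime x)).

Lemma point_filterE x (U : Poset AX) : val (point_filter x) U = val U x.
Proof. by []. Qed.

(** The improper filter comes from the maximum. For proper [P], a point outside every union of the
    complement of some [U] in [P] with some [V] not in [P] has [P] as its filter. If there were
    none, directedness and compactness would make a single such union cover [X], giving [U] below
    [V]. *)
Lemma point_filter_surj (P : optimals (Poset AX)) :
  exists x, point_filter x = P.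
Proof.
have fP := optimal_filter acu_brouwerian_algebra P.
have pP := @optimal_join_prime _ acu_brouwerian_algebra P.
have [PT|PT] := pselect (val P = setT).
  exists m; apply/val_inj/seteqP; split=> U; rewrite point_filterE PT// => _.
  exact: acu_pt.
have [V0 PV0] : exists V, ~ val P V.
  by apply/existsNP => PA; apply: PT; apply/seteqP; split.
have [[U0 PU0] Pup _] := fP.
pose D := [set S : set X | exists U V, [/\ val P U, ~ val P V & S = ~` val U
  `|` val V]].
have [x xD] : exists x, ~ (\bigcup_(S in D) S) x.
  apply: contrapT => /forallNP noD.
  have [||||S [U [V [PU PV ->]]] UV] :=
    compact_directed_cover Xcompact (D := D).
  - by exists (~` val U0 `|` val V0), U0, V0.
  - move=> _ [U [V [_ _ ->]]]; apply: openU; last by have [] := acu_clopen V.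
    by have [_ ?] := acu_clopen U; exact: closed_openC.
  - move=> _ _ [U [V [PU PV ->]]] [U' [V' [PU' PV' ->]]].
    exists (~` val (bmeet (U : Poset AX) U' : AX) `|` val (bjoin (V :
      Poset AX) V' : AX)); split.
    + exists (bmeet (U : Poset AX) U'), (bjoin (V : Poset AX) V'); split=> //;
      last by move=> /pP[].
      exact/(filter_bmeet acu_brouwerian_algebra).
    + by rewrite acu_bmeet acu_bjoin => y /= [Uy|Vy]; [left => -[]|right; left].
    + by rewrite acu_bmeet acu_bjoin => y /= [Uy|Vy]; [left => -[]|right;
      right].
  - by move=> x _; apply: contrapT; exact: noD.
  apply/PV/(Pup U) => //; apply/leAP => x Ux.
  by have [|//] := UV x I.
exists x; apply/val_inj/seteqP; split=> U; rewrite point_filterE.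
  move=> Ux; apply: contrapT => PU; apply: xD.
  by exists (~` val U0 `|` val U); [exists U0, U|right].
move=> PU; apply: contrapT => Ux; apply: xD.
by exists (~` val U `|` val V0); [exists U, V0|left].
Qed.

Lemma point_filter_mono : {mono point_filter : x y / x <= y}.
Proof.
move=> x y; apply/idP/idP => [/leOP xy|xy]; last first.
  by apply/leOP => U; rewrite !point_filterE => Ux; exact: acu_upset xy.
apply: contrapT => nxy.
have [S [Sc Sup Sx Sy]] := esakia_separation nxy.
(* An upset containing [x] contains the maximum, so the separating set is admissible. *)
by apply: Sy; apply: (xy (to_acu Sc Sup (Sup _ _ Sx (mtop x)))).
Qed.

Definition filter_point (P : optimals (Poset AX)) : X :=
  sval (boolp.cid (point_filter_surj P)).

Lemma filter_pointK : cancel filter_point point_filter.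
Proof. by move=> P; rewrite /filter_point; case: boolp.cid. Qed.

Lemma point_filterK : cancel point_filter filter_point.
Proof.
by move=> x; apply/eqP; rewrite eq_le -!point_filter_mono filter_pointK lexx.
Qed.

Lemma point_filter_continuous : continuous point_filter.
Proof.
apply: (subbase_continuous (@optimals_generated _)) => _ [[U _ <-]|[U _ <-]].
  by have [] := acu_clopen U.
by have [_ ?] := acu_clopen U; exact: closed_openC.
Qed.

Lemma filter_point_continuous : continuous filter_point.
Proof.
apply: can_continuous point_filter_continuous point_filterK filter_pointK.
  exact: Xcompact.
exact: optimals_hausdorff.
Qed.

Lemma point_filter_top : point_filter m = optimals_top _.
Proof.
by apply/val_inj/seteqP; split=> // U _; rewrite point_filterE; exact: acu_pt.
Qed.

End pointed_esakia.

(** * The functor A and its duality with X *)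

Section esakia_morphism.
Variables (X Y : triple) (f : X -> Y).
Hypotheses (esakiaX : pointed_esakia_space X) (esakiaY :
  pointed_esakia_space Y).
Hypothesis fmor : pesP_mor f.

Lemma pesP_mor_mono x y : x <= y -> f x <= f y.
Proof.
move=> xy; have [_ fdown _] := fmor.
have : down_closure (f @^-1` [set f y]) x by exists y.
by rewrite fdown => -[_ ->].
Qed.

Lemma pesP_mor_pt x : f x = tpt Y <-> x = tpt X.
Proof.
have [_ _ fpt] := fmor.
by have := congr1 (@^~ x) fpt; rewrite /preimage /= => ->.
Qed.

Lemma preimage_down_closure (S : set Y) :
  f @^-1` down_closure S = down_closure (f @^-1` S).
Proof.
have [_ fdown _] := fmor; apply/seteqP; split=> x.
  move=> [y Sy fxy]; have : (f @^-1` down_closure [set y]) x by exists y.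
  by rewrite -fdown => -[z fz xz]; exists z; rewrite //= fz.
by move=> [z Sfz xz]; exists (f z) => //; exact: pesP_mor_mono.
Qed.

Definition acu_preimage (U : admissible_clopen_upsets Y) :
  admissible_clopen_upsets X :=
  to_acu esakiaX (S := f @^-1` val U)
    (preimage_clopen (acu_clopen U) (let: And3 fc _ _ := fmor in fc))
    (fun x y Ux xy => acu_upset Ux (pesP_mor_mono xy))
    (eq_ind_r (val U) (acu_pt esakiaY U) ((pesP_mor_pt _).2 erefl)).

Lemma acu_preimage_mor : @brwAP_mor
  (Poset (admissible_clopen_upsets Y)) (Poset (admissible_clopen_upsets X))
  acu_preimage.
Proof.
have brwX := acu_brouwerian_algebra esakiaX.
have brwY := acu_brouwerian_algebra esakiaY.
have fmeets : @preserves_finite_meets _ _ (Poset (admissible_clopen_upsets Y))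
    (Poset (admissible_clopen_upsets X)) acu_preimage.
  apply: preserves_finite_meetsP; first by have [[]] := brwY.
    by move=> U /(acu_is_top esakiaY) UT; apply/(acu_is_top esakiaX);
      rewrite /= UT.
  move=> U V W /(acu_infimums esakiaY) eW.
  by apply/(acu_infimums esakiaX); rewrite /= eW.
have fjoins : @preserves_finite_joins _ _ (Poset (admissible_clopen_upsets Y))
    (Poset (admissible_clopen_upsets X)) acu_preimage.
  move=> S s Sf Ss; apply/supremumsP => W; split=> [/leAP sW _ [U SU <-]|SW].
    apply/leAP => x Ux; apply: sW; have [Sub _] := Ss.
    by have /leAP := Sub U SU; exact.
  apply/leAP => x sfx; apply: contrapT => Wx.
  (* Only the maximum is sent to the maximum, so some admissible clopen upset misses [f x]. This
     covers the empty join; with it, finite unions give an upper bound of [S] missing [f x], which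
     contradicts that [s] contains [f x]. *)
  have fxm : f x <> tpt Y.
    by move=> /pesP_mor_pt xm; apply: Wx; rewrite xm; exact: acu_pt.
  have [V [Vc Vup Vm Vfx]] := esakia_separation_pt esakiaY fxm.
  pose D := [set U : Poset (admissible_clopen_upsets Y) | ~ val U (f x)].
  have [||||U DU SU] := @finite_set_bound _ <=%O D S _ _ _ Sf.
  - by move=> ? ? ?; exact: le_trans.
  - by exists (to_acu esakiaY Vc Vup Vm).
  - move=> U U' DU DU'; exists (bjoin U U'); split.
    + by rewrite /D /= (acu_bjoin esakiaY) => -[].
    + exact: bjoinl.
    + exact: bjoinr.
  - move=> U SU Ufx; apply: Wx.
    by have /leAP := SW _ (ex_intro2 _ _ U SU erefl); exact.
  apply: DU; have /supremumsP/(_ U) [_ /(_ SU)/leAP] := Ss.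
  exact.
split=> //.
  move=> U V W /(acu_is_imp esakiaY) eW; apply/(acu_is_imp esakiaX).
  rewrite /= eW; apply: (congr1 setC).
  exact: (preimage_down_closure (val U `\` val V)).
move=> P Pprime; apply: prime_filter_preimage => //.
have [fP PT pP] := (prime_filterP brwX P).1 Pprime.
(* [P] is the filter of a point [x]. Properness makes [x] differ from the maximum, hence also [f x],
   and separation in [Y] gives a set whose preimage is not in [P]. *)
have [x ex] := point_filter_surj esakiaX (to_optimal brwX (conj fP pP)).
have PE U : P U = val U x by rewrite -(point_filterE esakiaX) ex.
have fxm : f x <> tpt Y.
  move=> /pesP_mor_pt xm; apply: PT; apply/seteqP; split=> // U _.
  by rewrite PE xm; exact: acu_pt.
have [V [Vc Vup Vm Vfx]] := esakia_separation_pt esakiaY fxm.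
by exists (to_acu esakiaY Vc Vup Vm); rewrite PE.
Qed.

End esakia_morphism.

Definition A_corestriction : corestriction PESP BrwAP A_obj A_map.
Proof.
refine (@Corestriction PESP BrwAP A_obj A_map
  (fun X => acu_brouwerian_algebra (svalP X))
  (fun X Y f => exist _ (acu_preimage (svalP X) (svalP Y) (svalP f))
                  (acu_preimage_mor (svalP X) (svalP Y) (svalP f))) _ _ _).
- by [].
- by move=> X; apply: chom_eq; apply/funext => U; exact: val_inj.
- by move=> X Y Z g f; apply: chom_eq; apply/funext => U; exact: val_inj.
Defined.

(** * Representation of a Brouwerian algebra by the clopen upsets of its dual space *)

Section representation.
Variable A : poset.
Hypothesis brwA : @brouwerian_algebra _ A.

Let XA : triple :=
  @Triple _ (optimals A) [set x | prime_filter (val x)] (optimals_top A).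
Let esakiaXA : pointed_esakia_space XA := optimals_pointed_esakia brwA.

Definition phi_acu (a : A) : Poset (admissible_clopen_upsets XA) :=
  to_acu esakiaXA (phi_clopen a) (@phi_upset A a) I.

Lemma phi_acuE a : val (phi_acu a) = phi a.
Proof. by []. Qed.

Lemma phi_acu_mono : {mono phi_acu : a b / a <= b}.
Proof.
move=> a b; apply/idP/idP => [/leAP ab|ab]; last first.
  apply/leAP => x xa; have [_ xup _] := optimal_filter brwA x.
  exact: xup ab.
apply: contrapT => nab.
have [|P [fP pP FP Pb]] := prime_separation1 brwA (up_closureP a) (b := b).
  by rewrite -[up_closure _]/(val (principal a)) in_principal.
apply: Pb; apply: (ab (to_optimal brwA (conj fP pP))).
by apply: FP; exists a.
Qed.

(** Compactness is used twice. For [y] outside [U], the sets [phi a] with [a] not in [y] cover [U]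
    and are directed since [y] is join-prime; there is such an [a] because [U] contains the improper
    filter. So one [phi a] contains [U] and misses [y]. Then the complements of the sets [phi a]
    containing [U] cover the complement of [U], and one suffices. *)
Lemma phi_acu_surj (U : Poset (admissible_clopen_upsets XA)) :
  exists a, phi_acu a = U.
Proof.
have [Uo Ucl] := acu_clopen U; have Uup := @acu_upset _ U.
have Utop : val U (optimals_top A) := acu_pt esakiaXA U.
have clopen_compact (S : set (optimals A)) : closed S -> compact S.
  by move=> Scl; exact: subclosed_compact Scl (optimals_compact brwA) _.
have sep y : ~ val U y -> exists2 a, val U `<=` phi a & ~ phi a y.
  move=> Uy; have fy := optimal_filter brwA y.
  have [a0 ya0] : exists a, ~ val y a.
    apply/existsNP => yT; apply: Uy; apply: Uup Utop _.
    by apply/leOP.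
  have [||||_ [a ya <-] Ua] :=
      compact_directed_cover (clopen_compact _ Ucl) (D := @phi A @` [set a | ~
        val y a]).
  - by exists (phi a0), a0.
  - by move=> _ [a _ <-]; have [] := phi_clopen a.
  - move=> _ _ [a ya <-] [b yb <-]; exists (phi (bjoin a b));
    rewrite phi_join//.
    split; [|by left|by right]; exists (bjoin a b); rewrite ?phi_join// => yab.
    by have [] := optimal_join_prime brwA yab.
  - move=> x Ux; have [a [xa ya]] : exists a, val x a /\ ~ val y a.
      apply: contrapT => noa; apply: Uy; apply: Uup Ux _; apply/leOP => a xa.
      by apply: contrapT => ya; apply: noa; exists a.
    by exists (phi a) => //; exists a.
  by exists a.
have Ccl : closed (~` val U) by exact: open_closedC.
have [t tT] := brw_top brwA.
have [||||_ [a Ua <-] aU] := compact_directed_cover (clopen_compact _ Ccl)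
    (D := (fun a => ~` phi a) @` [set a | val U `<=` phi a]).
- by exists (~` phi t), t => //=; rewrite (phi_top brwA tT).
- by move=> _ [a _ <-]; have [_ ?] := phi_clopen a; exact: closed_openC.
- move=> _ _ [a Ua <-] [b Ub <-]; exists (~` phi (bmeet a b)).
  rewrite phi_meet// setCI; split; [|by left|by right].
  exists (bmeet a b); rewrite /= phi_meet ?setCI// => x Ux.
  by split; [exact: Ua|exact: Ub].
- by move=> y /sep[a Ua ya]; exists (~` phi a) => //; exists a.
exists a; apply/val_inj/seteqP; split=> x; rewrite phi_acuE; last exact: Ua.
by move=> xa; apply: contrapT => Ux; exact: (aU x).
Qed.

Definition acu_generator (U : Poset (admissible_clopen_upsets XA)) : A :=
  sval (boolp.cid (phi_acu_surj U)).

Lemma acu_generatorK : cancel acu_generator phi_acu.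
Proof. by move=> U; rewrite /acu_generator; case: boolp.cid. Qed.

Lemma phi_acuK : cancel phi_acu acu_generator.
Proof.
by move=> a; apply/eqP; rewrite eq_le -!phi_acu_mono acu_generatorK lexx.
Qed.

End representation.

Lemma XA_equivalence : dual_equivalence X_corestriction A_corestriction.
Proof.
split; apply: naturally_isomorphic_sym.
  apply: (@concrete_natural_iso_op (op BrwAP) BrwAP (id_functor (op BrwAP))
    (comp_functor (flip_functor A_corestriction) X_corestriction)
    (fun A => phi_acu (svalP A)) (fun A => @acu_generator _ (svalP A))).
  - move=> A; apply: iso_brwAP_mor (phi_acuK _) (acu_generatorK _)
    (phi_acu_mono _).
      exact: svalP A.
    exact/acu_brouwerian_algebra/optimals_pointed_esakia/(svalP A).
  - move=> A; apply: iso_brwAP_mor (acu_generatorK _) (phi_acuK _) _.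
    + exact/acu_brouwerian_algebra/optimals_pointed_esakia/(svalP A).
    + exact: svalP A.
    + exact: can_mono_le (acu_generatorK _) (phi_acu_mono _).
  - by move=> A; exact: phi_acuK.
  - by move=> A; exact: acu_generatorK.
  - by move=> A B f a; exact: val_inj.
apply: (@concrete_natural_iso PESP PESP (id_functor PESP)
  (comp_functor X_corestriction (flip_functor A_corestriction))
  (fun X => point_filter (svalP X)) (fun X => @filter_point _ (svalP X))).
- move=> X; apply: (@iso_pesP_mor (sval X) (sval (X_corestriction
  (A_corestriction X)))
      _ (@filter_point _ (svalP X))).
  + exact: point_filterK.
  + exact: filter_pointK.
  + exact: point_filter_mono.
  + exact: point_filter_continuous.
  + exact: point_filter_top.
- move=> X; apply: (@iso_pesP_mor (sval (X_corestriction (A_corestriction X)))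
  (sval X)
      _ (point_filter (svalP X))).
  + exact: filter_pointK.
  + exact: point_filterK.
  + exact: can_mono_le (filter_pointK _) (point_filter_mono _).
  + exact: filter_point_continuous.
  + by rewrite /= -(point_filter_top (svalP X)) point_filterK.
- by move=> X; exact: point_filterK.
- by move=> X; exact: filter_pointK.
- by move=> X Y f x; exact: val_inj.
Qed.

(** * The functors Y and V *)

(* [fo] carries the functor [G] transported along the isomorphisms
   [iso A : G A -> fo A]. *)
Section transported_functor.
Variables (C D : concrete) (G : functor (op C) D) (fo : C -> raw D).
Variable fm : forall A B : C, (carrier (sval A) -> carrier (sval B)) ->
  (carrier (fo B) -> carrier (fo A)) -> Prop.
Hypothesis objP : forall A, is_obj (fo A).
Variables (iso : forall A : C, chom (sval (G A)) (fo A))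
          (inv : forall A : C, chom (fo A) (sval (G A))).
Hypotheses (isoK : forall A, cancel (sval (iso A)) (sval (inv A)))
           (invK : forall A, cancel (sval (inv A)) (sval (iso A))).

Let tmap (A B : C) (f : hom A B) : chom (fo B) (fo A) :=
  ccomp (iso A) (ccomp (@fmap _ _ G B A f : chom _ _) (inv B)).

Hypothesis mapP : forall (A B : C) (f : hom A B), fm (sval f) (sval (tmap f)).

Definition transported_corestriction : corestriction C D fo fm.
Proof.
refine (@Corestriction C D fo fm objP tmap mapP _ _) => [A|A B E g f].
  apply: chom_eq; apply/funext => x /=.
  by rewrite (@fmap_id _ _ G A) /= invK.
apply: chom_eq; apply/funext => x /=.
by rewrite (@fmap_comp _ _ G E B A f g) /= isoK.
Defined.

Lemma transported_natural_iso :
  naturally_isomorphic G transported_corestriction.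
Proof.
apply: (@concrete_natural_iso (op C) D G transported_corestriction
  (fun A => sval (iso A)) (fun A => sval (inv A))) => //.
- by move=> A; exact: svalP.
- by move=> A; exact: svalP.
- by move=> A B f x; rewrite /= isoK.
Qed.

End transported_functor.

(** * Points of an arithmetic Brouwerian frame as points of its compact elements *)

Section pseudoprime_points.
Variable L : poset.
Hypothesis objL : @is_obj BrwArFrm L.

Let algL : @algebraic_frame _ L. Proof. by case: objL => -[]. Qed.
Let supL (S : set L) : supremums S !=set0. Proof. by case: algL => -[]. Qed.
Let brwK := compact_brouwerian_algebra objL.

Lemma compact_not_le (x y : L) : ~ x <= y ->
  exists k, [/\ compact_elt k, k <= x & ~ k <= y].
Proof.
move=> xy; apply: contrapT => nok; apply: xy;
  apply: (algebraic_le algL) => k kc kx.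
by apply: contrapT => ky; apply: nok; exists k.
Qed.

(** If [a] and [b] are not below [p], they dominate compacts [k], [l] not below [p]. By
    arithmeticity the meet of [k] and [l] is compact, so being below [p] it is way below [p], and
    pseudoprimeness applies. Conversely, way below implies below. *)
Lemma pseudoprime_prime (p : L) : pseudoprime_elt p <-> prime_elt p.
Proof.
split=> -[ptop pprime]; split=> //.
  move=> a b m abm mp; apply: contrapT => /not_orP[ap bp].
  have [k [kc ka kp]] := compact_not_le ap;
    have [l [lc lb lp]] := compact_not_le bp.
  have [c klc] := frame_infimums supL [set k; l].
  have cc : compact_elt c by have [[_ meetL] _] := objL; exact: meetL klc.
  have cp : c <= p.
    apply: le_trans mp; move/infimums2P: abm => ->;
      move/infimums2P: klc => /(_ c).
    by rewrite lexx => /esym/andP[ck cl]; rewrite (le_trans ck)// (le_trans cl).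
  have [|_ [] ->//] := pprime [set k; l] c (finite_set2 k l) klc.
  by move=> S s Ss ps; apply: cc Ss (le_trans cp ps).
move=> S m Sf Sm mp; have {}mp : m <= p.
  have [|F [t [Fp _ Ft mt]]] := mp [set p] p _ (lexx p);
    first by rewrite supremums1.
  by apply: le_trans mt _; move/supremumsP: Ft => -> x /Fp ->.
elim/finite_set_ind: S / Sf m Sm mp => [m /infimums0P mtop mp|a S Sf IHS m].
  by case: ptop => x; exact: le_trans (mtop x) mp.
have [n Sn] := frame_infimums supL S.
move=> /(infimumsU1 _ _ Sn) anm /(pprime _ _ _ anm)[ap|np];
  first by exists a => //; left.
by have [x Sx xp] := IHS _ Sn np; exists x => //; right.
Qed.

Lemma bjoin_compact_inf (k l : compacts_dual L) :
  infimums [set compact_val k; compact_val l] (compact_val (bjoin k l)).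
Proof.
have /(compact_supremumsP objL) := bjoin_sup brwK k l.
by rewrite image_setU !image_set1.
Qed.

Lemma below_join_prime (p : L) : prime_elt p \/ is_top p ->
  join_prime (val (below objL p)).
Proof.
move=> [[_ pprime]|ptop] k l; last by left; exact: ptop.
exact: pprime (bjoin_compact_inf k l).
Qed.

(** Failure of primeness at [a] and [b] is witnessed by compacts below them, whose join in the
    reversed order is their meet in [L]. *)
Lemma join_prime_below (q : L) : join_prime (val (below objL q)) ->
  prime_elt q \/ is_top q.
Proof.
move=> qprime; have [qtop|qtop] := pselect (is_top q); [by right|left].
split=> // a b m abm mq; apply: contrapT => /not_orP[aq bq].
have [k [kc ka kq]] := compact_not_le aq;
  have [l [lc lb lq]] := compact_not_le bq.
have := bjoin_compact_inf (to_compact kc) (to_compact lc).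
set c := bjoin _ _; rewrite !to_compactK => klc.
have [|//|//] := qprime (to_compact kc) (to_compact lc).
rewrite in_below; apply: le_trans mq; move/infimums2P: abm => ->.
move/infimums2P: klc => /(_ (compact_val c)).
by rewrite lexx => /esym/andP[ck cl]; rewrite (le_trans ck)// (le_trans cl).
Qed.

Lemma point_prime (p : pseudoprimes L) : prime_elt (val p) \/ is_top (val p).
Proof. by case: (asboolW (valP p)) => [/pseudoprime_prime|]; [left|right]. Qed.

Definition point_below (p : pseudoprimes L) : optimals (compacts_dual L) :=
  to_optimal brwK (conj (below_filterP objL (val p)) (below_join_prime
    (point_prime p))).

Lemma point_belowE (p : pseudoprimes L) k :
  val (point_below p) k = (compact_val k <= val p) :> Prop.
Proof. by []. Qed.

Let ideal (F : optimals (compacts_dual L)) : filters (compacts_dual L) :=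
  Sub (val F) (asboolT (optimal_filter brwK F)).

Lemma below_ideal_join (F : optimals (compacts_dual L)) :
  val (below objL (ideal_join objL (ideal F))) = val F.
Proof. by rewrite ideal_joinK. Qed.

Lemma optimal_join_point (F : optimals (compacts_dual L)) :
  pseudoprime_elt (ideal_join objL (ideal F)) \/ is_top (ideal_join objL (ideal
    F)).
Proof.
rewrite pseudoprime_prime; apply: join_prime_below; rewrite below_ideal_join.
exact: optimal_join_prime.
Qed.

Definition optimal_join (F : optimals (compacts_dual L)) : pseudoprimes L :=
  Sub (ideal_join objL (ideal F)) (asboolT (optimal_join_point F)).

Lemma optimal_join_sup F : supremums (@compact_val L @` val F) (val
  (optimal_join F)).
Proof. exact: (ideal_join_sup objL (ideal F)). Qed.

Lemma optimal_joinK : cancel optimal_join point_below.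
Proof. by move=> F; apply: val_inj; exact: below_ideal_join. Qed.

Lemma point_below_mono : {mono point_below : p q / p <= q}.
Proof.
move=> p q.
have -> : (p <= q) = (below objL (val p) <= below objL (val q)) by rewrite
  below_mono.
by apply/idP/idP => [/leOP pq|/leFP pq]; [apply/leFP|apply/leOP].
Qed.

Lemma point_belowK : cancel point_below optimal_join.
Proof.
by move=> p; apply/eqP; rewrite eq_le -!point_below_mono optimal_joinK lexx.
Qed.

Lemma optimal_join_mono : {mono optimal_join : F G / F <= G}.
Proof. exact: can_mono_le optimal_joinK point_below_mono. Qed.

Lemma up_trace_clopen k : compact_elt k -> clopen (@up_trace L k).
Proof.
move=> kc; split; last (rewrite -[up_trace k]setCK; apply: open_closedC).
  by apply: (subbase_open (@pseudoprimes_generated L)); left; exists k.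
by apply: (subbase_open (@pseudoprimes_generated L)); right; exists k.
Qed.

Lemma point_below_continuous : continuous point_below.
Proof.
have trace_clopen (k : compacts_dual L) : clopen (point_below @^-1` phi k).
  exact: (up_trace_clopen (compact_valP (k := k))).
apply: (subbase_continuous (@optimals_generated _)) => _ [[k _ <-]|[k _ <-]].
  by have [] := trace_clopen k.
by have [_ ?] := trace_clopen k; exact: closed_openC.
Qed.

Lemma optimal_join_continuous : continuous optimal_join.
Proof.
have phiE k (kc : compact_elt k) :
  optimal_join @^-1` up_trace k = phi (to_compact kc).
  by apply/funext => F; rewrite -[in RHS](optimal_joinK F).
apply: (subbase_continuous (@pseudoprimes_generated L)) =>
  _ [[k kc <-]|[k kc <-]].
  by rewrite (phiE k kc); have [] := phi_clopen (to_compact kc).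
rewrite -[X in open X]/(~` (optimal_join @^-1` up_trace k)) (phiE k kc).
by have [_ ?] := phi_clopen (to_compact kc); exact: closed_openC.
Qed.

End pseudoprime_points.

Section pseudoprime_triple.
Variable L : BrwArFrm.

Lemma optimal_join_top :
  optimal_join (svalP L) (optimals_top (compacts_dual (sval L))) =
    pseudoprimes_top L.
Proof.
have ptop : is_top (val (pseudoprimes_top L)).
  by rewrite /pseudoprimes_top SubK; case: boolp.cid.
rewrite -[RHS](point_belowK (svalP L)); congr optimal_join.
by apply/val_inj/seteqP; split=> // k _; rewrite point_belowE.
Qed.

Lemma pseudoprimes_pointed_esakia : pointed_esakia_space (Y_obj L).
Proof.
apply: (@iso_pointed_esakia
  (sval (X_corestriction (K_restriction L))) (Y_obj L)
  (optimal_join (svalP L)) (point_below (svalP L))).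
- exact: optimal_joinK.
- exact: point_belowK.
- exact: optimal_join_mono.
- exact: optimal_join_continuous.
- exact: point_below_continuous.
- exact: optimal_join_top.
- have ptop : is_top (val (pseudoprimes_top L)).
    by rewrite /pseudoprimes_top SubK; case: boolp.cid.
  have brwK := compact_brouwerian_algebra (svalP L).
  apply/seteqP; split=> [_ [F /(prime_optimal brwK) Ftop <-]|p pprime].
    have [//|Jtop] := point_prime (svalP L) (optimal_join (svalP L) F).
    case: Ftop; rewrite -(optimal_joinK (svalP L) F); apply/val_inj/seteqP.
    by split=> // k _; rewrite point_belowE.
  exists (point_below (svalP L) p); last exact: point_belowK.
  apply/(prime_optimal brwK) => pT; have [nptop _] := pprime; apply: nptop.
  by rewrite -(point_belowK (svalP L) p) pT optimal_join_top.
- exact: (svalP (X_corestriction (K_restriction L))).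
Qed.

(** Left transparent, so that the underlying map reduces to [point_below] in the transported
    functor. *)
Definition point_below_hom :
  chom (Y_obj L) (sval (X_corestriction (K_restriction L))).
Proof.
exists (point_below (svalP L)).
apply: (@iso_pesP_mor (Y_obj L) (sval (X_corestriction (K_restriction L)))
  _ (optimal_join (svalP L))).
- exact: point_belowK.
- exact: optimal_joinK.
- exact: point_below_mono.
- exact: point_below_continuous.
- by rewrite /= -optimal_join_top optimal_joinK.
Defined.

Definition optimal_join_hom :
  chom (sval (X_corestriction (K_restriction L))) (Y_obj L).
Proof.
exists (optimal_join (svalP L)).
apply: (@iso_pesP_mor (sval (X_corestriction (K_restriction L))) (Y_obj L)
  _ (point_below (svalP L))).
- exact: optimal_joinK.
- exact: point_belowK.
- exact: optimal_join_mono.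
- exact: optimal_join_continuous.
- exact: optimal_join_top.
Defined.

End pseudoprime_triple.

Definition Y_corestriction : corestriction BrwArFrm PESP Y_obj Y_map.
Proof.
refine (@transported_corestriction BrwArFrm PESP
  (comp_functor X_corestriction (op_functor K_restriction)) Y_obj Y_map
  pseudoprimes_pointed_esakia optimal_join_hom point_below_hom _ _ _).
- by move=> L; exact: optimal_joinK.
- by move=> L; exact: point_belowK.
move=> L M f b /=; set F := optimal_preimage _ _ _ _.
have [_ fmeets _ _] := svalP f.
have /supremumsP JP := optimal_join_sup (svalP L) F.
(* The transported map joins only the compacts that [f] sends below [b]. This agrees with the right
   adjoint, as every [a] with [f a] below [b] is the join of such compacts. *)
apply/supremumsP => x; rewrite JP; split=> [Fx a /= fab|ax _ [k Fk <-]];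
  last exact: ax.
apply: algebraic_le => [|k kc ka]; first by have [[]] := svalP L.
apply: Fx; exists (to_compact kc) => //.
exact: le_trans (preserves_meets_le fmeets ka) fab.
Defined.

Lemma Y_natural_iso : naturally_isomorphic
  (comp_functor X_corestriction (op_functor K_restriction)) Y_corestriction.
Proof. exact: transported_natural_iso. Qed.

(** * Admissible closed upsets as filters of admissible clopen upsets *)

Section closed_upsets.
Variable X : triple.
Hypothesis esakiaX : pointed_esakia_space X.

Let AX := Poset (admissible_clopen_upsets X).
Let brwAX : @brouwerian_algebra _ AX := acu_brouwerian_algebra esakiaX.

Lemma closed_val_closed (C : Va_dual X) : closed (closed_val C).
Proof. by have [] := asboolW (valP (C : admissible_closed_upsets X)). Qed.

Lemma closed_val_upset (C : Va_dual X) : is_upset (closed_val C).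
Proof. by have [] := asboolW (valP (C : admissible_closed_upsets X)). Qed.

Lemma closed_val_pt (C : Va_dual X) : closed_val C (tpt X).
Proof.
have [adm _ up] := asboolW (valP (C : admissible_closed_upsets X)).
exact/(admissible_upset esakiaX up).
Qed.

Definition to_closed (S : set X) (Scl : closed S) (Sup : is_upset S)
    (Sm : S (tpt X)) : Va_dual X :=
  Sub S (asboolT (And3 ((admissible_upset esakiaX Sup).2 Sm) Scl Sup)) :
    admissible_closed_upsets X.

Definition filter_inter (F : filters AX) : set X :=
  \bigcap_(U in val F) val (U : admissible_clopen_upsets X).

Lemma filter_inter_closed F : closed (filter_inter F).
Proof. by apply: closed_bigI => U _; have [] := acu_clopen U. Qed.

Lemma filter_inter_upset F : is_upset (filter_inter F).
Proof. by move=> x y Fx xy U FU; exact: acu_upset (Fx U FU) xy. Qed.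

Lemma filter_inter_pt F : filter_inter F (tpt X).
Proof. by move=> U _; exact: acu_pt. Qed.

Definition filter_closed (F : filters AX) : Va_dual X :=
  to_closed (@filter_inter_closed F) (@filter_inter_upset F) (@filter_inter_pt
    F).

Lemma filter_closedE F : closed_val (filter_closed F) = filter_inter F.
Proof. by []. Qed.

Lemma above_filterP (C : Va_dual X) : is_filter [set U :
  AX | closed_val C `<=` val U].
Proof.
apply/(is_filterP brwAX); split.
- by have [W eW] := acu_setT esakiaX; exists W; rewrite /= eW.
- by move=> U V /= CU /leAP UV x /CU /UV.
- by move=> U V /= CU CV; rewrite (acu_bmeet esakiaX) => x Cx; split;
  [exact: CU|exact: CV].
Qed.

Definition above (C : Va_dual X) : filters AX :=
  Sub [set U : AX | closed_val C `<=` val U] (asboolT (above_filterP C)).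

Let Xcompact : compact [set: X]. Proof. by case: esakiaX => -[]. Qed.

Let closed_compact (S : set X) : closed S -> compact S.
Proof. by move=> Scl; exact: subclosed_compact Scl Xcompact _. Qed.

(** For [x] outside the closed upset [C], the clopen upsets missing [x] form a directed cover of
    [C]. One of them contains [C], and with it the maximum, so it is admissible. *)
Lemma aboveK : cancel above filter_closed.
Proof.
move=> C; apply: val_inj; rewrite -[RHS]/(closed_val C).
apply/seteqP; split=> x; last by move=> Cx U; exact.
move=> Cx; apply: contrapT => nCx.
pose D := [set S : set X | [/\ clopen S, is_upset S & ~ S x]].
have [||||S [Sc Sup Sx] CS] :=
    compact_directed_cover (closed_compact (@closed_val_closed C)) (D := D).
- by exists set0; split=> //; exact: clopen0.
- by move=> S [[]].
- move=> S T [Sc Sup Sx] [Tc Tup Tx]; exists (S `|` T); split=> //.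
  split; [exact: clopenU| |by case].
  by move=> y z [Sy|Ty] yz; [left; exact: Sup yz|right; exact: Tup yz].
- move=> y Cy; have [|S [Sc Sup Sy Sx]] :=
  esakia_separation esakiaX (x := y) (y := x).
    by move=> yx; apply: nCx; exact: closed_val_upset yx.
  by exists S.
apply: Sx; apply: (Cx (to_acu esakiaX Sc Sup (CS _ (closed_val_pt C)))).
exact: CS.
Qed.

(** If the intersection of [F] lies in [U], the complements of members of [F] form a directed cover
    of the compact complement of [U]; hence some member is contained in [U]. *)
Lemma filter_closedK : cancel filter_closed above.
Proof.
move=> F; apply/val_inj/seteqP; split=> U; last by move=> FU x; exact.
have fF := asboolW (valP F); have [[U0 FU0] Fup _] := fF.
move=> FU; have [Uo _] := acu_clopen U.
have [|||||_ [V FV <-] UV] := compact_directed_cover (C := ~` val U)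
    (D := (fun V : AX => ~` val V) @` val F).
- by apply: closed_compact; exact: open_closedC.
- by exists (~` val U0), U0.
- by move=> _ [V _ <-]; have [_ ?] := acu_clopen V; exact: closed_openC.
- move=> _ _ [V FV <-] [W FW <-]; exists (~` val (bmeet V W)).
  rewrite (acu_bmeet esakiaX) setCI; split; [|by left|by right].
  exists (bmeet V W); last by rewrite (acu_bmeet esakiaX) setCI.
  exact/(filter_bmeet brwAX _ _ fF).
- move=> x Ux; apply: contrapT => nV; apply: Ux; apply: FU => V FV.
  by apply: contrapT => Vx; apply: nV; exists (~` val V) => //; exists V.
apply: Fup FV _; apply/leAP => x Vx; apply: contrapT => Ux; exact: (UV x).
Qed.

Lemma above_mono : {mono above : C D / C <= D}.
Proof.
have leV (C D : Va_dual X) : C <= D <-> closed_val D `<=` closed_val C.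
  by rewrite /Order.le /= -subsetEset.
move=> C D; apply/idP/idP => [/leFP CD|/leV DC]; last first.
  by apply/leFP => U CU x /DC /CU.
apply/leV => x Dx; rewrite -[C]aboveK => U CU.
by have := CD U CU; exact.
Qed.

Lemma filter_closed_mono : {mono filter_closed : F G / F <= G}.
Proof. exact: can_mono_le filter_closedK above_mono. Qed.

End closed_upsets.

Section closed_upsets_frame.
Variable X : PESP.

Let FAX := sval (F_restriction (A_corestriction X)).

Lemma closed_upsets_brwArFrm : @is_obj BrwArFrm (V_obj X).
Proof.
apply: (@iso_brwArFrm_obj FAX (V_obj X) (filter_closed (svalP X)) (above (svalP
  X))).
- exact: filter_closedK.
- exact: aboveK.
- exact: filter_closed_mono.
- exact: (svalP (F_restriction (A_corestriction X))).
Qed.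

Definition filter_closed_hom : @chom BrwArFrm FAX (V_obj X).
Proof.
exists (filter_closed (svalP X)).
apply: (@iso_brwArFrm_mor FAX (V_obj X) _ (above (svalP X))).
- exact: filter_closedK.
- exact: aboveK.
- exact: filter_closed_mono.
Defined.

Definition above_hom : @chom BrwArFrm (V_obj X) FAX.
Proof.
exists (above (svalP X)).
apply: (@iso_brwArFrm_mor (V_obj X) FAX _ (filter_closed (svalP X))).
- exact: aboveK.
- exact: filter_closedK.
- exact: above_mono.
Defined.

End closed_upsets_frame.

Definition V_corestriction : corestriction PESP BrwArFrm V_obj V_map.
Proof.
refine (@transported_corestriction PESP BrwArFrm
  (comp_functor F_restriction A_corestriction) V_obj V_map
  closed_upsets_brwArFrm filter_closed_hom above_hom _ _ _).
- by move=> X; exact: filter_closedK.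
- by move=> X; exact: aboveK.
move=> X Y f C.
suff : filter_inter (sval (fmap (comp_functor F_restriction A_corestriction) f)
    (above (svalP Y) C)) = sval f @^-1` closed_val C by [].
(* With [C] written as the intersection of the admissible clopen upsets above it, both sides are
   intersections of preimages of these sets. *)
rewrite -[in RHS](aboveK (svalP Y) C) filter_closedE; apply/seteqP; split=> x.
  move=> Cx U CU; apply: (Cx (acu_preimage (svalP X) (svalP Y) (svalP f) U)).
  by apply/in_filter_image; exists U.
by move=> Cx W /in_filter_image[U CU /leAP]; apply; exact: Cx.
Defined.

Lemma V_natural_iso : naturally_isomorphic
  (comp_functor F_restriction A_corestriction) V_corestriction.
Proof. exact: transported_natural_iso. Qed.

Theorem theorem4p28 :
  exists (F : restriction BrwAP BrwArFrm F_obj F_map)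
         (K : restriction BrwArFrm BrwAP K_obj K_map)
         (X : corestriction BrwAP PESP X_obj X_map)
         (A : corestriction PESP BrwAP A_obj A_map)
         (Y : corestriction BrwArFrm PESP Y_obj Y_map)
         (V : corestriction PESP BrwArFrm V_obj V_map),
    equivalence F K /\
    dual_equivalence X A /\
    dual_equivalence Y V /\
    naturally_isomorphic (comp_functor Y (op_functor F)) X /\
    naturally_isomorphic (comp_functor F A) V.
Proof.
exists F_restriction, K_restriction, X_corestriction, A_corestriction,
  Y_corestriction, V_corestriction.
have [KF FK] := FK_equivalence; have [AX XA] := XA_equivalence.
split; first by split.
split; first by split.
split; [split|split; last exact: V_natural_iso].
(* The composite of [V] after [Y] is [F A X K] up to isomorphism; cancelling [A X] and then [F K]
   leaves the identity. *)
- have YX := naturally_isomorphic_sym Y_natural_iso.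
  have VFA := naturally_isomorphic_flip (naturally_isomorphic_sym
    V_natural_iso).
  apply: naturally_isomorphic_trans (naturally_isomorphic_compr _ VFA) _.
  apply: naturally_isomorphic_trans (naturally_isomorphic_compl _ YX) _.
  apply: (@naturally_isomorphic_trans _ _ _
    (comp_functor (op_functor F_restriction) (op_functor K_restriction))).
    exact: (naturally_isomorphic_compl (op_functor F_restriction)
      (naturally_isomorphic_compr (op_functor K_restriction) AX)).
  exact: (naturally_isomorphic_op FK).
(* In the other order the composite is [X K F A], where [K F] and then [X A] cancel. *)
- have YX := naturally_isomorphic_sym Y_natural_iso.
  have VFA := naturally_isomorphic_flip (naturally_isomorphic_sym
    V_natural_iso).
  apply: naturally_isomorphic_trans (naturally_isomorphic_compl _ VFA) _.
  apply: naturally_isomorphic_trans (naturally_isomorphic_compr _ YX) _.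
  apply: naturally_isomorphic_trans XA.
  exact: (naturally_isomorphic_compl X_corestriction
    (naturally_isomorphic_compr (flip_functor A_corestriction)
      (naturally_isomorphic_op KF))).
(* [Y F] becomes [X K F], and [K F] cancels. *)
- have YX := naturally_isomorphic_sym Y_natural_iso.
  apply: naturally_isomorphic_trans (naturally_isomorphic_compr _ YX) _.
  exact: (naturally_isomorphic_compl X_corestriction (naturally_isomorphic_op
    KF)).
Qed.
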